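(* Let $f:S^1\to S^1$ be a $C^2$-diffeomorphism without periodic points. Then $$\lim_{n\to\infty}\frac{\Gamma_n(f)}{n^2}=0 .$$
   Context: $S^1=\mathbb{R}/\mathbb{Z}$. For a $C^1$-diffeomorphism $f:S^1\to S^1$, $f^n$ denotes the $n$-th iterate (with $f^{-n}$ the $n$-th iterate of the inverse), $\lVert Df^n\rVert=\max_{x\in S^1}|Df^n(x)|$, and the growth sequence of $f$ is $\Gamma_n(f)=\max\{\lVert Df^n\rVert,\lVert Df^{-n}\rVert\}$ for $n\in\mathbb{N}$. *)

(* Defs.v *)
From mathcomp Require Import all_boot all_order all_algebra.
From mathcomp Require Import all_classical all_reals all_analysis.
Import Order.TTheory GRing.Theory Num.Theory.
Import numFieldTopology.Exports numFieldNormedType.Exports.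

Set Implicit Arguments.
Unset Strict Implicit.
Unset Printing Implicit Defensive.

Local Open Scope classical_set_scope.
Local Open Scope ring_scope.
Local Open Scope quotient_scope.

Definition circle (R : realType) :=
  Quotient.quot (GRing.ZmodClosed.clone R (@Num.int_num_subdef R) _).


Section CircleMaps.
Context {R : realType}.

Definition circle_proj (t : R) : circle R := \pi_(circle R) t.

(* The representative of y in [-1/2, 1/2[. For each p, the map
   y |-> centered_repr (y - p) is a chart of R/Z around p, whose inverse is
   h |-> p + circle_proj h. *)
Definition centered_repr (y : circle R) : R :=
  repr y - (Num.floor (repr y + 2^-1))%:~R.

(* Difference quotients at x read in the charts around x and f x. The jump of
   centered_repr at the class of 1/2 is harmless: if the quotients converge as
   h --> 0, then f (x + h) - f x tends to 0 in R/Z. *)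
Definition circle_quotient (f : circle R -> circle R) (x : circle R) (h : R)
  : R := centered_repr (f (x + circle_proj h) - f x) / h.

Definition circle_derivable (f : circle R -> circle R) (x : circle R) : Prop :=
  cvg (circle_quotient f x h @[h --> 0^']).

Definition circle_derive (f : circle R -> circle R) (x : circle R) : R :=
  lim (circle_quotient f x h @[h --> 0^']).

(* A real function on R/Z is C^1 iff its pull-back to R is. *)
Definition circle_C2 (f : circle R -> circle R) : Prop :=
  (forall x, circle_derivable f x) /\
  let Df : R -> R := circle_derive f \o circle_proj in
  (forall t, derivable Df t 1) /\ continuous (derive1 Df).

(* The inverse map when f is bijective. *)
Definition circle_inv (f : circle R -> circle R) : circle R -> circle R :=
  fun y => xget 0 [set x | f x = y].

Definition C2_diffeomorphism (f : circle R -> circle R) : Prop :=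
  [/\ bijective f, circle_C2 f & circle_C2 (circle_inv f)].

Definition periodic_point (f : circle R -> circle R) (x : circle R) : Prop :=
  exists2 n : nat, (0 < n)%N & iter n f x = x.

(* For a C^1 map the supremum is attained, so this is the maximum. *)
Definition derive_norm (f : circle R -> circle R) : R :=
  sup [set `|circle_derive f x| | x in [set: circle R]].

Definition growth (f : circle R -> circle R) (n : nat) : R :=
  Num.max (derive_norm (iter n f)) (derive_norm (iter n (circle_inv f))).

End CircleMaps.

(* Main.v *)
(** Since f has no periodic point it preserves orientation; let F be a lift and
    write L_n = log D(F^n), the Birkhoff sum of g = log DF. Let p_k/q_k be the
    convergents of the rotation number and T_k = F^(q_k) - p_k; consecutive T_k
    move points in opposite directions, and the images under F of the intervals
    [x, T_k x] and [x, T_(k+1) x] tile the circle. This gives the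
    Denjoy-Koksma inequality, bounded distortion, and |T_k x - x| -> 0.

    The decisive point is that L_(q_k) tends to 0 uniformly. A limit of the
    discrepancies of two orbit segments of length q_k is an F-invariant signed
    measure with bounded density; where that density almost attains its supremum
    p, the defect from p is small on a tile, hence, by invariance and bounded
    distortion, on all its images, which cover the circle. The total mass is 0,
    so p = 0: the limit measure vanishes.

    Then |D L_(q_(k+1))| is o(1/|T_k x - x|), so the positive function
    delta = |T_(k+1) x - x| has |delta'|^2 = o(delta/|T_k x - x|), and 1/sqrt(delta)
    moves slowly along the orbit of T_(k+1). Hence D(F^(b q_(k+1))) <= (1 + e b)^2
    for b up to the next partial quotient. Writing n in the numeration of the q_k,
    these factors multiply to o(n^2). *)

Require Import Defs.
From mathcomp Require Import all_boot all_order all_algebra.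
From mathcomp Require Import all_classical all_reals all_analysis.
From mathcomp Require Import ring lra zify.
Import Order.TTheory GRing.Theory Num.Theory.
Import numFieldTopology.Exports numFieldNormedType.Exports.
Set Implicit Arguments.
Unset Strict Implicit.
Unset Printing Implicit Defensive.
Local Open Scope classical_set_scope.
Local Open Scope ring_scope.

(** * Real functions *)

Section RealFunctions.
Context {R : realType}.
Implicit Types (f df : R -> R) (a b x y : R).

(** A discrepancy controls L_n because the difference of two Birkhoff sums of g is the integral of
    g' against a counting function of the two orbit segments, and Denjoy-Koksma bounds that
    function. If its limits vanish, so does the limit of L_(q_k). No measure is built: a limit
    density is encoded by the interval function [disc psi a b], its integral against d psi over
    [a, b], and invariance becomes a change of variable in psi.

    The exponent 2 has one source: a positive function whose second derivative is at most s
    satisfies delta'^2 <= 2 s delta. So delta changes by O(delta^(3/2)) at each step of the tower,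
    1/sqrt(delta) by O(1), and delta at most quadratically in the number of steps.

    The estimates concern exp(|L_n|/2): the absolute value treats F^n and F^(-n) together, and the
    half makes a digit b cost the linear factor 1 + e b. When partial quotients stay bounded the
    product of these factors must lose against the bare growth of q_k, hence the fixed gain 3/4 per
    level. *)

Definition between a b x := (a <= x <= b) || (b <= x <= a).

Lemma betweenl a b : between a b a.
Proof. by rewrite /between lexx andbT /=; apply: le_total. Qed.

Lemma betweenC a b x : between a b x = between b a x.
Proof. by rewrite /between orbC. Qed.

Lemma betweenr a b : between a b b.
Proof. by rewrite betweenC betweenl. Qed.

Lemma between_shrink (a b x y z : R) :
  between a b x -> between a b y -> between x y z -> between a b z.
Proof.
by move=> /orP[] h1 /orP[] h2 /orP[] h3; apply/orP; solve [left; lra | right; lra].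
Qed.

Lemma between_homo f a b x :
  {homo f : u v / u <= v} -> between a b x -> between (f a) (f b) (f x).
Proof.
by move=> hf /orP[]/andP[/hf h1 /hf h2]; rewrite /between h1 h2 ?orbT.
Qed.

Lemma between_dist a b x y :
  between a b x -> between a b y -> `|x - y| <= `|a - b|.
Proof.
by move=> /orP[] hx /orP[] hy; case: (ger0P (x - y)) => h1;
  case: (ger0P (a - b)) => h2; lra.
Qed.

Lemma is_derive_continuous f (d : R) x : is_derive x 1 f d -> {for x, continuous f}.
Proof. by move=> [h _]; exact/differentiable_continuous/derivable1_diffP. Qed.

Lemma MVT_between f df a b : (forall x, is_derive x 1 f (df x)) ->
  exists2 c, between a b c & f b - f a = df c * (b - a).
Proof.
move=> fdf.
have fc a' b' : {within `[a', b'], continuous f}.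
  by apply: continuous_subspaceT => x; exact: is_derive_continuous.
case: (leP a b) => ab.
  have [c + ->] := MVT_segment ab (fun x _ => fdf x) (fc a b).
  by rewrite in_itv /= => h; exists c => //; rewrite /between h.
have [c + h2] := MVT_segment (ltW ab) (fun x _ => fdf x) (fc b a).
by rewrite in_itv /= => h; exists c; [rewrite /between h orbT|lra].
Qed.

Definition uniformly_continuous f := forall e : R, 0 < e -> exists2 d : R, 0 < d &
  forall x y : R, `|x - y| <= d -> `|f x - f y| <= e.

Lemma periodicz f : (forall x, f (x + 1) = f x) ->
  forall x (m : int), f (x + m%:~R) = f x.
Proof.
move=> f1 x; have f1n n : f (x + n%:R) = f x.
  by elim: n => [|n ih]; rewrite ?addr0// -natr1 addrA f1.
have fn1 n : f (x - n%:R) = f x.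
  elim: n => [|n ih]; rewrite ?subr0// -ih -natr1.
  by rewrite -[in RHS](subrK 1 (x - n%:R)) f1; congr f; ring.
case=> n; first exact: f1n.
by rewrite NegzE mulrNz; exact: fn1.
Qed.

Lemma periodic_continuous_bounded f : continuous f ->
  (forall x, f (x + 1) = f x) -> exists2 M, 0 <= M & forall x, `|f x| <= M.
Proof.
move=> fc f1.
have cn : {within `[0, 1], continuous (fun x => `|f x|)}.
  by apply: continuous_subspaceT => x; apply: continuous_comp; [exact: fc|exact: norm_continuous].
have [c _ hc] := EVT_max (@ler01 R) cn.
exists `|f c| => // x.
rewrite -[x](subrK (Num.floor x)%:~R) periodicz//; apply: hc.
rewrite in_itv /=; have := Num.Theory.floor_itv x.
rewrite intrD; lra.
Qed.

Lemma periodic_uniformly_continuous f : continuous f ->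
  (forall x, f (x + 1) = f x) -> uniformly_continuous f.
Proof.
move=> fc f1 e e0.
apply: contrapT => /forall2NP hN.
have e20 : 0 < e / 2 by lra.
have /choice[xy hxy] (n : nat) : exists z : R * R,
    `|z.1 - z.2| <= n.+1%:R^-1 /\ e < `|f z.1 - f z.2|.
  apply: contrapT => h; case: (hN n.+1%:R^-1) => // hn; apply: hn => x y h1.
  by rewrite leNgt; apply/negP => h2; apply: h; exists (x, y).
(* Both points are shifted by the same integer, which keeps their distance; [v n] may leave [0, 1]
   and is only compared with [u n]. *)
pose u n := (xy n).1 - (Num.floor (xy n).1)%:~R.
pose v n := (xy n).2 - (Num.floor (xy n).1)%:~R.
have uv n : `|u n - v n| <= n.+1%:R^-1.
  have [+ _] := hxy n; rewrite /u /v; congr (_ <= _); congr `|_|; ring.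
have fuv n : e < `|f (u n) - f (v n)|.
  have [_ +] := hxy n.
  by rewrite /u /v -mulrNz !periodicz.
have uI n : u n \in `[0, 1].
  rewrite in_itv /= /u; have := Num.Theory.floor_itv (xy n).1; rewrite intrD; lra.
have [t tcl] : exists t : R, cluster (u @ \oo) t.
  have /(_ (u @ \oo)) [] := @segment_compact R 0 1.
    by exists 0%N => // n _; exact: uI.
  by move=> t [_ tcl]; exists t.
have /cvgrPdist_lt/(_ _ e20)/nbhs_ballP[d /= d0 hd] : f x @[x --> t] --> f t by exact: fc.
have d20 : 0 < d / 2 by lra.
have [] := tcl [set u n | n in [set n | n.+1%:R^-1 < d / 2]] (ball t (d / 2)).
- exists (Num.truncn (d/2)^-1).+1 => // n /= hn; exists n => //=.
  rewrite invf_plt ?posrE//.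
  have := Num.Theory.truncnS_gt (d/2)^-1; move=> /lt_le_trans; apply.
  by rewrite ler_nat (leq_trans hn).
- exact: nbhsx_ballx.
move=> _ [[n /= hn <-] btu].
have tu : `|t - u n| < d / 2 := btu.
have tv : `|t - v n| < d.
  apply: le_lt_trans (ler_distD (u n) _ _) _; have := le_lt_trans (uv n) hn; lra.
have h1 := hd (u n); have h2 := hd (v n).
rewrite /ball /= in h1 h2.
have {}h1 := h1 (lt_trans tu (ltac:(lra) : d / 2 < d)).
have {}h2 := h2 tv.
have := fuv n; apply/negP; rewrite -leNgt.
by apply: le_trans (ler_distD (f t) _ _) _; rewrite (distrC (f (u n))); lra.
Qed.

End RealFunctions.

Section Primitive.
Context {R : realType}.

Lemma exists_primitive_itv (D : R -> R) (a : R) : continuous D -> a < 0 ->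
  exists P : R -> R, P 0 = 0 /\ forall x : R, a < x -> is_derive x 1 P (D x).
Proof.
move=> Dc a0; pose P x := (\int[lebesgue_measure]_(t in [set` `[a, x]]) (D t))%R.
exists (fun x => P x - P 0); split; first by rewrite subrr.
move=> x ax.
have [h1 h2] : derivable P x 1 /\ derive1 P x = D x.
  apply: (@continuous_FTC1_closed R D a x (x + 1)) => //; first by rewrite ltrDl.
    apply: continuous_compact_integrable; first exact: segment_compact.
    exact: continuous_subspaceT.
  exact: Dc.
have h : is_derive x 1 P (D x) by split => //; rewrite -h2 derive1E.
by rewrite -[D x]subr0; apply: is_deriveB.
Qed.

(** Integration from a base point gives a primitive only to its right. Normalised at 0, the
    primitives for different base points agree where both are defined, and [P (N x) x] glues
    them. *)
Lemma exists_primitive (D : R -> R) : continuous D ->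
  exists P : R -> R, forall x : R, is_derive x 1 P (D x).
Proof.
move=> Dc.
have /choice[P hP] (n : nat) : exists P : R -> R, P 0 = 0 /\
    forall x : R, - n.+1%:R < x -> is_derive x 1 P (D x).
  by apply: exists_primitive_itv => //; rewrite oppr_lt0.
have agree m n y : - m.+1%:R < y -> - n.+1%:R < y -> P m y = P n y.
  move=> my ny; have [Pm0 dm] := hP m; have [Pn0 dn] := hP n.
  have m0 : - m.+1%:R < 0 :> R by rewrite oppr_lt0.
  have n0 : - n.+1%:R < 0 :> R by rewrite oppr_lt0.
  have dmn x : Num.min 0 y <= x -> is_derive x 1 (P m - P n) 0.
    move=> hx; have h1 : is_derive x 1 (P m) (D x).
      by apply: dm; apply: lt_le_trans hx; rewrite lt_min m0.
    have h2 : is_derive x 1 (P n) (D x).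
      by apply: dn; apply: lt_le_trans hx; rewrite lt_min n0.
    by rewrite -(subrr (D x)); exact: is_deriveB.
  have e0 : (P m - P n) 0 = 0 by rewrite -[LHS]/(P m 0 - P n 0) Pm0 Pn0 subrr.
  suff : (P m - P n) y = 0 by move=> /eqP; rewrite -[X in X == _]/(P m y - P n y) subr_eq0 => /eqP.
  have [y0|y0] := leP 0 y.
    have [||z _] := @MVT_segment R (P m - P n) (fun=> 0) 0 y y0.
    - by move=> x; rewrite in_itv /= => /andP[h _]; apply: dmn; rewrite ge_min ltW.
    - apply: derivable_within_continuous => x; rewrite in_itv /= => /andP[h _].
      by have [] : is_derive x 1 (P m - P n) 0 by apply: dmn; rewrite ge_min h.
    by rewrite mul0r e0 subr0.
  have [||z _] := @MVT_segment R (P m - P n) (fun=> 0) y 0 (ltW y0).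
  - by move=> x; rewrite in_itv /= => /andP[h _]; apply: dmn; rewrite ge_min (ltW h) orbT.
  - apply: derivable_within_continuous => x; rewrite in_itv /= => /andP[h _].
    by have [] : is_derive x 1 (P m - P n) 0 by apply: dmn; rewrite ge_min h orbT.
  by rewrite mul0r e0 sub0r => /eqP; rewrite oppr_eq0 => /eqP.
pose N (x : R) := (Num.truncn `|x|).+1.
exists (fun x => P (N x) x) => x.
have hN (y : R) : `|x - y| < 1 -> - (N x).+1%:R < y.
  move=> xy; have := Num.Theory.truncnS_gt `|x|; rewrite -/(N x) -natr1 => h.
  have := ler_norm (- x); rewrite normrN => h2; move: xy; rewrite ltr_norml => /andP[]; lra.
have hx : is_derive x 1 (P (N x)) (D x).
  by have [_] := hP (N x); apply; apply: hN; rewrite subrr normr0.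
apply: near_eq_is_derive hx; rewrite ?oner_neq0//.
near=> y; apply: agree.
  by apply: hN; near: y; apply: (nbhsx_ballx x 1).
have := Num.Theory.truncnS_gt `|y|; rewrite -/(N y) -natr1 => h.
by have := ler_norm (- y); rewrite normrN; lra.
Unshelve. all: by end_near. Qed.

End Primitive.

(** * Iterates of a lift and convergents of its rotation number *)

(* [lslope] is the logarithm of the derivative of [lmap]. *)
Record free_lift (R : realType) := FreeLift {
  lmap :> R -> R;
  lslope : R -> R;
  dlslope : R -> R;
  lmapD1 : forall x, lmap (x + 1) = lmap x + 1;
  lslopeD1 : forall x, lslope (x + 1) = lslope x;
  dlslopeD1 : forall x, dlslope (x + 1) = dlslope x;
  lmap_surj : forall y, exists x, lmap x = y;
  lmap_derive : forall x : R, is_derive x 1 lmap (expR (lslope x));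
  lslope_derive : forall x : R, is_derive x 1 lslope (dlslope x);
  dlslope_continuous : continuous dlslope;
  lmap_free : forall n (m : int) x, (0 < n)%N -> iter n lmap x <> x + m%:~R }.

Section Iterates.
Context {R : realType} (F : free_lift R).
Implicit Types (x y : R) (n q : nat) (m p : int).

Lemma ltr_lmap : {mono F : x y / x < y}.
Proof.
have hlt x y : x < y -> F x < F y.
  move=> xy; have [c _] := MVT_between x y (lmap_derive F).
  have := mulr_gt0 (expR_gt0 (lslope F c)) (_ : 0 < y - x); rewrite subr_gt0 => /(_ xy).
  lra.
move=> x y; case: (ltrgtP x y) => [/hlt//|/hlt h|->]; last by rewrite ltxx.
by apply/negbTE; rewrite -leNgt ltW.
Qed.

Lemma ltr_iter n : {mono iter n F : x y / x < y}.
Proof. by elim: n => [|n ih] x y //=; rewrite ltr_lmap ih. Qed.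

Lemma ler_iter n : {mono iter n F : x y / x <= y}.
Proof. by move=> x y; rewrite !leNgt ltr_iter. Qed.

Lemma iterD1 n x : iter n F (x + 1) = iter n F x + 1.
Proof. by elim: n x => [|n ih] x //=; rewrite ih lmapD1. Qed.

Lemma iterDz n x m : iter n F (x + m%:~R) = iter n F x + m%:~R.
Proof.
have /= := @periodicz R (fun x => iter n F x - x).
move=> h; have := h (fun x => ltac:(rewrite iterD1; ring)) x m; lra.
Qed.

Lemma iter_surj n y : exists x, iter n F x = y.
Proof.
elim: n y => [|n ih] y; first by exists y.
by have [z <-] := lmap_surj F y; have [x <-] := ih z; exists x.
Qed.

Definition lsum n x := \sum_(i < n) lslope F (iter i F x).

Definition dlsum n x := \sum_(i < n) dlslope F (iter i F x) * expR (lsum i x).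

Lemma lsum0 x : lsum 0 x = 0. Proof. by rewrite /lsum big_ord0. Qed.

Lemma lsumS n x : lsum n.+1 x = lsum n x + lslope F (iter n F x).
Proof. by rewrite /lsum big_ord_recr. Qed.

Lemma lsumD n k x : lsum (n + k) x = lsum n x + lsum k (iter n F x).
Proof.
elim: k => [|k ih]; first by rewrite addn0 lsum0 addr0.
by rewrite addnS !lsumS ih addrA addnC iterD.
Qed.

Lemma lsumD1 n x : lsum n (x + 1) = lsum n x.
Proof. by apply: eq_bigr => i _; rewrite iterD1 lslopeD1. Qed.

Lemma lsumDz n x m : lsum n (x + m%:~R) = lsum n x.
Proof. exact: (periodicz (lsumD1 n)). Qed.

Lemma iter_derive n x : is_derive x 1 (iter n F) (expR (lsum n x)).
Proof.
elim: n => [|n ih]; first by rewrite lsum0 expR0; exact: is_derive_id.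
rewrite lsumS addrC expRD.
have h := lmap_derive F (iter n F x).
exact: is_derive1_comp.
Qed.

Lemma lsum_derive n x : is_derive x 1 (lsum n) (dlsum n x).
Proof.
rewrite /lsum /dlsum.
have h (i : 'I_n) : is_derive x 1 (fun x => lslope F (iter i F x))
    (dlslope F (iter i F x) * expR (lsum i x)).
  have h1 := iter_derive i x; have h2 := lslope_derive F (iter i F x).
  exact: (@is_derive1_comp _ (lslope F) (iter i F)).
have := @is_derive_sum R R R n (fun i x => lslope F (iter i F x)) x 1 _ h.
by rewrite (_ : \sum_(i < n) _ = fun x => \sum_(i < n) lslope F (iter i F x))//;
  apply/funext => y; rewrite fct_sumE.
Qed.

Definition ret q p x := iter q F x - p%:~R.

Lemma ret_comp q p q' p' x : ret q p (ret q' p' x) = ret (q + q') (p + p') x.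
Proof. by rewrite /ret -mulrNz iterDz -iterD !mulrNz intrD; ring. Qed.

Lemma retD1 q p x : ret q p (x + 1) = ret q p x + 1.
Proof. by rewrite /ret iterD1; ring. Qed.

Lemma ret_derive q p x : is_derive x 1 (ret q p) (expR (lsum q x)).
Proof.
have h := iter_derive q x.
by rewrite -[expR _](subr0); apply: is_deriveB.
Qed.

Lemma ret_continuous q p : continuous (ret q p).
Proof. by move=> x; apply: is_derive_continuous; exact: ret_derive. Qed.

Lemma iter_ret n q p x : iter n F (ret q p x) = ret q p (iter n F x).
Proof. by rewrite /ret -mulrNz iterDz mulrNz -!iterD addnC. Qed.

Lemma ret_neq q p x : (0 < q)%N -> ret q p x != x.
Proof.
move=> q0; apply/eqP => h; apply: (@lmap_free _ F q p x q0).
by move: h; rewrite /ret; lra.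
Qed.

(** The displacement never vanishes, so it has constant sign by the intermediate value theorem. The
    sign is kept as a factor s so that both directions share one argument. *)
Lemma ret_sign q p : (0 < q)%N -> exists2 s : R, s ^+ 2 = 1 &
  forall x, 0 < s * (ret q p x - x).
Proof.
move=> q0; pose d x := ret q p x - x.
have dc (a b : R) : {within `[a, b], continuous d}.
  apply: continuous_subspaceT => x; apply: continuousB; last exact: cvg_id.
  exact: ret_continuous.
have dn0 x : d x != 0 by rewrite subr_eq0 ret_neq.
have key x y : d x < 0 -> 0 < d y -> False.
  move=> dx dy.
  have [xy|xy] := leP x y.
    have [|c _ /eqP] := @IVT _ d x y 0 xy (dc _ _); last by rewrite (negbTE (dn0 c)).
    by rewrite ge_min le_max (ltW dx) (ltW dy) orbT.
  have [|c _ /eqP] := @IVT _ d y x 0 (ltW xy) (dc _ _); last by rewrite (negbTE (dn0 c)).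
  by rewrite ge_min le_max (ltW dx) (ltW dy) orbT.
have [h|h|h] := ltrgtP (d 0) 0.
- exists (-1) => [|x]; first by rewrite sqrrN expr1n.
  rewrite mulN1r oppr_gt0 lt_neqAle dn0 leNgt; apply/negP; exact: key h.
- exists 1 => [|x]; first by rewrite expr1n.
  rewrite mul1r lt_neqAle eq_sym dn0 leNgt; apply/negP => h1; exact: key h1 h.
- by have := dn0 0; rewrite h eqxx.
Qed.

Lemma ret_displacement q p (s : R) : (forall x, 0 < s * (ret q p x - x)) ->
  exists2 c, 0 < c & forall x, c <= s * (ret q p x - x).
Proof.
move=> hs; pose d x := s * (ret q p x - x).
have dc : {within `[0, 1], continuous d}.
  apply: continuous_subspaceT => x; apply: cvgM; first exact: cvg_cst.
  by apply: continuousB; [exact: ret_continuous|exact: cvg_id].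
have [c _ hc] := EVT_min (@ler01 R) dc.
exists (d c); first exact: hs.
move=> x; rewrite -/(d x) -[x](subrK (Num.floor x)%:~R) periodicz.
  apply: hc; rewrite in_itv /=; have := Num.Theory.floor_itv x.
  rewrite intrD; lra.
by move=> y; rewrite /d retD1; congr (_ * _); ring.
Qed.

End Iterates.

(* The convergents p_k / q_k of the rotation number, shifted by one:
   (q_0, p_0) = (0, 1) and q_1 = 1. By [ret_side], [F^(q_k) - p_k] moves every
   point to the left when k is even and to the right when k is odd. *)
Record convergents (R : realType) (F : free_lift R) := Convergents {
  cq : nat -> nat;
  cp : nat -> int;
  ca : nat -> nat;
  cq0 : cq 0 = 0%N;
  cp0 : cp 0 = 1;
  cq1 : cq 1 = 1%N;
  cqSS : forall k, cq k.+2 = (ca k * cq k.+1 + cq k)%N;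
  cpSS : forall k, cp k.+2 = (ca k)%:Z * cp k.+1 + cp k;
  ca_gt0 : forall k, (0 < ca k)%N;
  ret_side : forall k x, (-1) ^+ k * (ret F (cq k) (cp k) x - x) < 0 }.

(** * The continued fraction algorithm *)

Section Construction.
Context {R : realType} (F : free_lift R).

(** The current return, the previous one (primed) and the direction [ss] of the current one. The
    last clause of [cf_valid] says that one current step does not yet cancel the previous return; it
    makes the next partial quotient positive. *)
Record cf_state := CFState { sq : nat; sp : int; sq' : nat; sp' : int; ss : R }.

Definition cf_valid (st : cf_state) :=
  [/\ (0 < sq st)%N, (ss st) ^+ 2 = 1,
   forall x, 0 < ss st * (ret F (sq st) (sp st) x - x),
   forall x, ss st * (ret F (sq' st) (sp' st) x - x) < 0 &
   forall x, ss st * (ret F (sq st + sq' st) (sp st + sp' st) x - x) < 0].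

Lemma ret_sign_uniform q p (s x0 : R) : (0 < q)%N -> s ^+ 2 = 1 ->
  0 < s * (ret F q p x0 - x0) -> forall x, 0 < s * (ret F q p x - x).
Proof.
move=> q0 s2 h x; have [t t2 ht] := ret_sign F p q0.
have : s * t = 1 \/ s * t = -1.
  have /eqP : (s * t) ^+ 2 = 1 by rewrite exprMn s2 t2 mulr1.
  by rewrite sqrf_eq1 => /orP[]/eqP; [left|right].
case=> st.
- have -> : s = t by rewrite -[t]mul1r -s2 expr2 -mulrA st mulr1.
  exact: ht.
- have e : s = - t by rewrite -[t]mul1r -s2 expr2 -mulrA st mulrN1 opprK.
  have := ht x0; move: h; rewrite e; lra.
Qed.

Lemma cf_step (st : cf_state) : cf_valid st -> exists a st',
  [/\ cf_valid st', (0 < a)%N, sq st' = (a * sq st + sq' st)%N,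
      sp st' = a%:Z * sp st + sp' st &
      [/\ sq' st' = sq st, sp' st' = sp st & ss st' = - ss st]].
Proof.
case: st => q p q' p' s [/= q0 s2 hq hq' hqq'].
pose T n x := ret F (n * q + q') (n%:Z * p + p') x.
have TS n x : T n.+1 x = ret F q p (T n x).
  rewrite /T ret_comp mulSn addnA; congr (ret _ _ _ _).
  by rewrite -addn1 PoszD; ring.
have [c c0 hc] := ret_displacement hq.
have Tn n : n%:R * c + s * (T 0%N 0) <= s * T n 0.
  elim: n => [|n ih]; first by rewrite mul0r add0r.
  rewrite TS -natr1; have := hc (T n 0); lra.
have ex : exists n, 0 < s * T n 0.
  exists (Num.truncn (- (s * T 0%N 0) / c)).+1.
  have := Num.Theory.truncnS_gt (- (s * T 0%N 0) / c).
  rewrite ltr_pdivrMr// => h.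
  have := Tn (Num.truncn (- (s * T 0%N 0) / c)).+1; lra.
(* The first n for which n current steps outweigh the previous return. The last two clauses of
   [cf_valid] exclude 0 and 1, so n = a + 1 with a > 0, and a is the partial quotient. Only the
   orbit of 0 is inspected; [ret_sign_uniform] passes to all points. *)
case: (ex_minnP ex) => [[|a]] ha hmin.
  by have := hq' 0; move: ha; rewrite /T mul0n mul0r !add0n add0r subr0; lra.
have a0 : (0 < a)%N.
  case: a ha {hmin} => // ha; have := hqq' 0.
  by move: ha; rewrite /T mul1n mul1r subr0; lra.
exists a, (CFState (a * q + q') (a%:Z * p + p') q p (- s)).
split=> //; split => /=.
- by rewrite addn_gt0 muln_gt0 a0 q0.
- by rewrite sqrrN.
- apply: (@ret_sign_uniform _ _ _ 0).
  + by rewrite addn_gt0 muln_gt0 a0 q0.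
  + by rewrite sqrrN.
  + have T0 : T a 0 != 0 by apply: ret_neq; rewrite addn_gt0 muln_gt0 a0 q0.
    rewrite subr0 mulNr oppr_gt0 -/(T a 0) lt_neqAle; apply/andP; split.
      by rewrite mulf_neq0//; apply: contraTneq isT => s0; move/eqP: s2; rewrite s0 expr0n /= eq_sym oner_eq0.
    by rewrite leNgt; apply/negP => /hmin; rewrite ltnn.
- by move=> x; have := hq x; lra.
- move=> x.
  have -> : (a * q + q' + q)%N = (a.+1 * q + q')%N by rewrite mulSn; lia.
  have -> : a%:Z * p + p' + p = a.+1%:Z * p + p' by rewrite -addn1 PoszD; ring.
  have := @ret_sign_uniform (a.+1 * q + q') (a.+1%:Z * p + p') s 0 _ s2 _ x.
  rewrite subr0 -/(T a.+1 0) => /(_ _ ha); rewrite addn_gt0 muln_gt0 q0 => /(_ isT); lra.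
Qed.

Lemma convergents_exist : inhabited (convergents F).
Proof.
pose p1 := Num.floor (F 0).
have q0 : (0 < 1)%N by [].
have := Num.Theory.floor_itv (F 0); rewrite -/p1 intrD => /andP[h1 h2].
(* The previous return is the translation by -1, with q = 0; the current one is F - floor (F 0),
   which moves 0, hence every point, to the right. *)
have v0 : cf_valid (CFState 1 p1 0 1 1).
  have r0 : 0 < 1 * (ret F 1 p1 0 - 0).
    have := ret_neq F p1 0 q0; rewrite /ret /= subr0 mul1r; lra.
  have r1 : 0 < -1 * (ret F 1 (p1 + 1) 0 - 0).
    have := ret_neq F (p1 + 1) 0 q0; rewrite /ret /= subr0 intrD; lra.
  split=> //=; first by rewrite expr1n.
  - exact: (ret_sign_uniform q0 (expr1n _ _) r0).
  - by move=> x; rewrite /ret /=; lra.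
  - move=> x; have := ret_sign_uniform q0 _ r1 x; rewrite sqrrN expr1n => /(_ erefl); lra.
have /choice[f hf] (st : {st | cf_valid st}) : exists r : nat * {st | cf_valid st},
    [/\ (0 < r.1)%N, sq (sval r.2) = (r.1 * sq (sval st) + sq' (sval st))%N,
      sp (sval r.2) = r.1%:Z * sp (sval st) + sp' (sval st) &
      [/\ sq' (sval r.2) = sq (sval st), sp' (sval r.2) = sp (sval st) & ss (sval r.2) = - ss (sval st)]].
  case: st => st vst; have [a [st' [v' ? ? ? ?]]] := cf_step vst.
  by exists (a, exist _ st' v').
pose S k := iter k (fun st => (f st).2) (exist _ _ v0).
pose q k := sq' (sval (S k)); pose p k := sp' (sval (S k)).
have qS k : q k.+1 = sq (sval (S k)) by have [_ _ _ []] := hf (S k).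
have pS k : p k.+1 = sp (sval (S k)) by have [_ _ _ []] := hf (S k).
have sS k : ss (sval (S k)) = (-1) ^+ k.
  elim: k => [|k ih]; first by [].
  by have [_ _ _ [_ _ e]] := hf (S k); rewrite exprS mulN1r -ih.
constructor; apply: (@Convergents _ _ q p (fun k => (f (S k)).1)) => //.
- by move=> k; rewrite !qS; have [_ -> _ _] := hf (S k).
- by move=> k; rewrite !pS; have [_ _ -> _] := hf (S k).
- by move=> k; have [-> _ _ _] := hf (S k).
- by move=> k x; rewrite -sS; have [_ _ _ + _] := svalP (S k); apply.
Qed.

End Construction.

Section Convergents.
Context {R : realType} (F : free_lift R) (c : convergents F).
Implicit Types (x y : R) (k n : nat).

Definition cret k := ret F (cq c k) (cp c k).

Lemma cq_gt0 k : (0 < cq c k.+1)%N.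
Proof.
elim: k => [|k ih]; first by rewrite cq1.
by rewrite cqSS addn_gt0 muln_gt0 ca_gt0 ih.
Qed.

Lemma cq_leS k : (cq c k <= cq c k.+1)%N.
Proof.
case: k => [|k]; first by rewrite cq0.
by rewrite cqSS (leq_trans (leq_pmull _ (ca_gt0 c k)))// leq_addr.
Qed.

(** Strict growth starts only at index 2: [cq c 2] equals [ca c 0], which may be 1 like [cq c 1]. *)
Lemma cq_ltSS k : (cq c k.+2 < cq c k.+3)%N.
Proof.
rewrite (cqSS c k.+1) -[X in (X < _)%N]addn0 -addnS leq_add ?cq_gt0//.
by rewrite leq_pmull// ca_gt0.
Qed.

Lemma cq_ge k : (k <= cq c k.+1)%N.
Proof.
elim: k => // -[|[|k]] ih; rewrite ?cq_gt0//.
  by have := cq_ltSS 0; have := cq_gt0 1; lia.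
by have := cq_ltSS k.+1; lia.
Qed.

Lemma cdet k : (-1) ^+ k *
  ((cq c k.+1)%:Z * cp c k - (cq c k)%:Z * cp c k.+1) = 1 :> int.
Proof.
elim: k => [|k ih]; first by rewrite cq1 cp0 cq0; ring.
rewrite cqSS cpSS PoszD PoszM -[RHS]ih exprS; ring.
Qed.

(* [phi] of degree [d]: summing the increments of [phi] over the two families
   of intervals telescopes, and leaves [d] times the determinant [cdet]. *)
Lemma tile_sum k (phi : R -> R) (d : R) x : (forall x, phi (x + 1) = phi x + d) ->
  (-1) ^+ k * (\sum_(i < cq c k.+1) (phi (iter i F x) - phi (iter i F (cret k x))) +
    \sum_(i < cq c k) (phi (iter i F (cret k.+1 x)) - phi (iter i F x))) = d.
Proof.
move=> phi1.
have phiz y (m : int) : phi (y - m%:~R) = phi y - m%:~R * d.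
  rewrite -mulrNz; have h := periodicz (f := fun x => phi x - x * d).
  have := h (fun x => ltac:(rewrite phi1; ring)) y (- m); rewrite mulrNz; lra.
have step q p n : \sum_(i < n) phi (iter i F (ret F q p x)) =
    \sum_(q <= i < q + n) phi (iter i F x) - n%:R * p%:~R * d.
  have -> : \sum_(q <= i < q + n) phi (iter i F x) = \sum_(i < n) phi (iter (i + q) F x).
    by rewrite -{1}[q]add0n big_addn addKn big_mkord.
  rewrite -mulrA mulr_natl -[X in _ *+ X]card_ord -sumr_const -sumrB.
  by apply: eq_bigr => i _; rewrite iter_ret /ret phiz -iterD addnC.
(* Both families reassemble the sum over the first q + q' iterates, cut once at q and once at q';
   after cancellation only the degree terms remain. *)
have cut m n : \sum_(0 <= i < m + n) phi (iter i F x) =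
    \sum_(0 <= i < m) phi (iter i F x) + \sum_(m <= i < m + n) phi (iter i F x).
  by rewrite -big_cat_nat ?leq_addr.
rewrite !sumrB /cret !step.
set q := cq c k; set q' := cq c k.+1.
have e1 := cut q q'; have e2 := cut q' q.
rewrite -!(big_mkord xpredT (fun i => phi (iter i F x))).
have det : (-1) ^+ k * (q'%:R * (cp c k)%:~R - q%:R * (cp c k.+1)%:~R) = 1 :> R.
  have /(congr1 (fun z : int => z%:~R : R)) := cdet k.
  by rewrite intrM rmorphXn/= rmorphN1 intrB !intrM -!pmulrn.
rewrite -[RHS]mul1r -[in RHS]det -[RHS]mulrA; congr (_ * _).
move: e1 e2; rewrite (addnC q' q); lra.
Qed.

End Convergents.

(** * Dynamical tilings and distortion *)

Section Tilings.
Context {R : realType} (F : free_lift R) (c : convergents F).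
Implicit Types (x y z : R) (k n i j : nat).

Lemma cret_iter k n x : iter n F (cret c k x) = cret c k (iter n F x).
Proof. exact: iter_ret. Qed.

Lemma cret_surj k y : exists x, cret c k x = y.
Proof.
have [x hx] := iter_surj F (cq c k) (y + (cp c k)%:~R).
by exists x; rewrite /cret /ret hx addrK.
Qed.

Lemma signr_homo k (phi : R -> R) x y : {homo phi : u v / u <= v} ->
  (-1) ^+ k * (x - y) <= 0 -> (-1) ^+ k * (phi x - phi y) <= 0.
Proof.
move=> hphi; rewrite -signr_odd; case: (odd k); rewrite /= ?expr0 ?expr1 => h.
  have : phi y <= phi x by apply: hphi; lra.
  lra.
have : phi x <= phi y by apply: hphi; lra.
lra.
Qed.

(** For monotone phi all increments in [tile_sum] get the same sign, so absolute values cost nothing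
    and the tiling becomes exact: phi = id says that the lengths add up to 1, and a step function
    shows that every point is covered. *)
Lemma tile_dist k (phi : R -> R) (d : R) x :
  {homo phi : u v / u <= v} -> (forall x, phi (x + 1) = phi x + d) ->
  \sum_(i < cq c k.+1) `|phi (iter i F (cret c k x)) - phi (iter i F x)| +
  \sum_(i < cq c k) `|phi (iter i F (cret c k.+1 x)) - phi (iter i F x)| = d.
Proof.
move=> hphi phi1; rewrite -[RHS](tile_sum c k x phi1) mulrDr !mulr_sumr.
have hpi i : {homo (fun x => phi (iter i F x)) : u v / u <= v}.
  by move=> u v uv; apply: hphi; rewrite ler_iter.
congr (_ + _); apply: eq_bigr => i _.
- rewrite distrC -(normrMsign k) ger0_norm//.
  have := signr_homo (hpi i) (ltW (ret_side c k x)); rewrite -/(cret c k x) /=; lra.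
- rewrite -(normrMsign k) ger0_norm//.
  have := signr_homo (hpi i) (ltW (ret_side c k.+1 x)).
  rewrite -/(cret c k.+1 x) /= exprS; lra.
Qed.

Lemma tile_dist_le k (phi : R -> R) (d : R) x n :
  {homo phi : u v / u <= v} -> (forall x, phi (x + 1) = phi x + d) ->
  (n <= cq c k.+1)%N ->
  \sum_(i < n) `|phi (iter i F (cret c k x)) - phi (iter i F x)| <= d.
Proof.
move=> hphi phi1 nq; rewrite -[leRHS](tile_dist k x hphi phi1).
apply: ler_wpDr; first by apply: sumr_ge0 => i _.
rewrite -!(big_mkord xpredT (fun i => `|phi (iter i F (cret c k x)) - phi (iter i F x)|)).
by rewrite (big_cat_nat (leq0n n) nq)/= lerDl; apply: sumr_ge0.
Qed.

Lemma iter_cret k n x : iter n (cret c k) x =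
  ret F (n * cq c k) (n%:Z * cp c k) x.
Proof.
elim: n => [|n ih]; first by rewrite mul0n mul0r /ret subr0.
rewrite /= ih /cret ret_comp mulSn; congr (ret _ _ _ _).
by rewrite -[in RHS]addn1 PoszD; ring.
Qed.

(** After [ca c k] steps of T_(k+1) the point T_k x has become T_(k+2) x, which is still on the same
    side of x as T_k x; the earlier steps lie in between. *)
Lemma between_tower k b x : (b <= ca c k)%N ->
  between x (cret c k x) (iter b (cret c k.+1) (cret c k x)).
Proof.
move=> ba; set y := cret c k x.
have e : iter (ca c k) (cret c k.+1) y = cret c k.+2 x.
  by rewrite iter_cret /y /cret ret_comp cqSS cpSS.
have := ret_side c k.+2 x; rewrite -/(cret c k.+2 x) -e.
have up n z : 0 <= (-1) ^+ k * (iter n (cret c k.+1) z - z).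
  elim: n => [|n ih]; first by rewrite subrr mulr0.
  have := ret_side c k.+1 (iter n (cret c k.+1) z).
  rewrite -/(cret c k.+1 _) -iterS exprS; lra.
have := up b y; have := up (ca c k - b)%N (iter b (cret c k.+1) y).
rewrite -iterD subnK// !exprS /between -[_ ^+ k]signr_odd.
by case: (odd k); rewrite ?expr0 ?expr1; lra.
Qed.

Definition cdisp k x := `|cret c k x - x|.

Lemma cdisp_gt0 k x : 0 < cdisp k x.
Proof.
rewrite normr_gt0; apply: contraTneq (ret_side c k x) => h.
by rewrite -/(cret c k x) h mulr0 ltxx.
Qed.

Lemma cdisp_sum k x n : (n <= cq c k.+1)%N ->
  \sum_(i < n) cdisp k (iter i F x) <= 1.
Proof.
move=> nq; have := @tile_dist_le k id 1 x n.
under eq_bigr do rewrite cret_iter; apply => //.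
Qed.

(** [tile_dist] for the step function floor (t - y), of degree 1: some tile has a nonzero increment,
    hence contains an integer translate of y. *)
Lemma hitting k x y : exists i z v (m : int), [/\ (i <= cq c k.+1)%N,
  iter i F v = y + m%:~R, between z (cret c k z) v & between z (cret c k z) x].
Proof.
pose phi (t : R) : R := (Num.floor (t - y))%:~R.
have hphi : {homo phi : u v / u <= v}.
  by move=> u v uv; rewrite /phi ler_int; apply: Num.Theory.le_floor; rewrite lerD2r.
have phi1 t : phi (t + 1) = phi t + 1.
  rewrite /phi (_ : Num.floor (t + 1 - y) = Num.floor (t - y) + 1) ?intrD//.
  apply: Num.Theory.floor_def; have := Num.Theory.floor_itv (t - y).
  rewrite !intrD; lra.
have hit a b : phi a != phi b -> exists m : int, between a b (y + m%:~R).
  have key u v : u <= v -> phi u != phi v -> u <= y + (Num.floor (v - y))%:~R <= v.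
    move=> uv; have /andP[h1 _] := Num.Theory.floor_itv (v - y) => /eqP ne.
    apply/andP; split; last by move: h1; lra.
    rewrite leNgt; apply/negP => h; apply: ne; apply/eqP; rewrite eq_le hphi//=.
    by rewrite /phi ler_int Num.Theory.floor_ge_int; move: h; lra.
  case: (leP a b) => [ab /(key _ _ ab) h|/ltW ba ne].
    by exists (Num.floor (b - y)); rewrite /between h.
  by exists (Num.floor (a - y)); rewrite /between key ?orbT// eq_sym.
have : exists i u, [/\ (i <= cq c k.+1)%N, phi (iter i F u) != phi (iter i F x) &
    u = cret c k x \/ u = cret c k.+1 x].
  apply: contrapT => h.
  have := tile_dist k x hphi phi1; rewrite !big1 ?addr0; first by move/eqP; rewrite eq_sym oner_eq0.
  - move=> i _; apply/normr0P; rewrite subr_eq0; apply: contrapT => /negP ne.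
    by apply: h; exists i, (cret c k.+1 x); split; [rewrite (leq_trans (ltnW (ltn_ord i)))// cq_leS|exact: ne|right].
  - move=> i _; apply/normr0P; rewrite subr_eq0; apply: contrapT => /negP ne.
    by apply: h; exists i, (cret c k x); split; [exact: ltnW|exact: ne|left].
move=> [i [u [iq /hit[m hm] hu]]].
have [v hv] := iter_surj F i (y + m%:~R).
have buv : between u x v.
  by move: hm; rewrite -hv /between !ler_iter.
case: hu => hu.
  by exists i, x, v, m; split=> //; rewrite -?hu ?betweenl// betweenC.
(* A tile based on [x, T_(k+1) x] is enclosed in [z, T_k z] with T_k z = x. *)
have [z hz] := cret_surj k x.
have bx : between z (cret c k z) x by rewrite hz betweenr.
exists i, z, v, m; split=> //.
apply: between_shrink bx buv.
have := @between_tower k 1 z (ca_gt0 c k); by rewrite /= hz -hu.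
Qed.

(** Two orbits are compared directly, without an invariant measure. First x is moved to a point v of
    the same interval [z, T_k z] ([near]), then v along its orbit to y ([far]). Each move costs 2 d,
    a bound for the variation of phi - d id over a period. *)
Lemma denjoy_koksma k (phi : R -> R) (d : R) x y :
  {homo phi : u v / u <= v} -> (forall x, phi (x + 1) = phi x + d) ->
  `| \sum_(i < cq c k.+1) (phi (iter i F x) - d * iter i F x) -
     \sum_(i < cq c k.+1) (phi (iter i F y) - d * iter i F y)| <= 4 * d.
Proof.
move=> hphi phi1; pose chi t := phi t - d * t.
pose H n t := \sum_(i < n) chi (iter i F t).
rewrite -/(H _ x) -/(H _ y).
have d0 : 0 <= d by have := hphi 0 (0 + 1); rewrite phi1; lra.
have chi1 t : chi (t + 1) = chi t by rewrite /chi phi1; ring.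
have Hz n t (m : int) : H n (t + m%:~R) = H n t.
  by apply: eq_bigr => i _; rewrite iterDz periodicz.
have chi_le i u v a b : between a b u -> between a b v ->
    `|chi (iter i F u) - chi (iter i F v)| <=
    `|phi (iter i F b) - phi (iter i F a)| + d * `|iter i F b - iter i F a|.
  move=> hu hv.
  have h1 : `|iter i F u - iter i F v| <= `|iter i F a - iter i F b|.
    by apply: between_dist; apply: between_homo => // s t; rewrite ler_iter.
  have h2 : `|phi (iter i F u) - phi (iter i F v)| <= `|phi (iter i F a) - phi (iter i F b)|.
    apply: between_dist; apply: (@between_homo _ (fun x => phi (iter i F x))) => // s t st;
      by apply: hphi; rewrite ler_iter.
  rewrite [X in `|X|](_ : _ = (phi (iter i F u) - phi (iter i F v)) -
    d * (iter i F u - iter i F v)); last by rewrite /chi; ring.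
  apply: le_trans (ler_normB _ _) _; rewrite normrM (ger0_norm d0) ![`|_ (iter _ _ b) - _|]distrC.
  by rewrite (distrC (iter i F b)) lerD// ler_wpM2l.
have tile2 j z n : (n <= cq c j.+1)%N -> \sum_(i < n)
    (`|phi (iter i F (cret c j z)) - phi (iter i F z)| + d * `|iter i F (cret c j z) - iter i F z|)
    <= d + d.
  move=> nq; rewrite big_split /= -mulr_sumr lerD ?tile_dist_le//.
  by rewrite -[leRHS]mulr1 ler_wpM2l// (@tile_dist_le j id)//.
have near z u v : between z (cret c k z) u -> between z (cret c k z) v ->
    `|H (cq c k.+1) u - H (cq c k.+1) v| <= d + d.
  move=> hu hv; apply: le_trans (tile2 k z _ (leqnn _)).
  rewrite -sumrB; apply: le_trans (ler_norm_sum _ _ _) _.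
  by apply: ler_sum => i _; exact: chi_le.
have far j z : (j <= cq c k.+2)%N ->
    `|H (cq c k.+1) (iter j F z) - H (cq c k.+1) z| <= d + d.
  move=> jq; apply: le_trans (tile2 k.+1 z _ jq).
  (* Exchanging the two orbit lengths turns a shift of the starting point by j iterates into a sum
     of length j over the short interval [z, T_(k+1) z]. *)
  have -> : H (cq c k.+1) (iter j F z) - H (cq c k.+1) z =
      H j (cret c k.+1 z) - H j z.
    have Hadd m n t : H (m + n)%N t = H m t + H n (iter m F t).
      rewrite /H big_split_ord /=; congr (_ + _).
      by apply: eq_bigr => i _; rewrite -iterD addnC.
    have := Hadd j (cq c k.+1) z; have := Hadd (cq c k.+1) j z; rewrite addnC.
    rewrite /cret /ret -mulrNz Hz; lra.
  rewrite -sumrB; apply: le_trans (ler_norm_sum _ _ _) _.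
  by apply: ler_sum => i _; apply: chi_le; rewrite ?betweenl ?betweenr.
have [i [z [v [m [iq hv bv bx]]]]] := hitting k x y.
have h1 := near _ _ _ bx bv.
have := far i v (leq_trans iq (cq_leS _ _)); rewrite hv Hz => h2.
rewrite (distrC (H _ y)) in h2.
apply: le_trans (ler_distD (H (cq c k.+1) v) _ _) _; lra.
Qed.

End Tilings.

Section Distortion.
Context {R : realType} (F : free_lift R) (c : convergents F) (M : R).
Hypothesis dlslope_le : forall x, `|dlslope F x| <= M.
Implicit Types (x y z u v : R) (k n i j : nat).

Let M_ge0 : 0 <= M. Proof. exact: le_trans (normr_ge0 _) (dlslope_le 0). Qed.

Lemma lslope_lipschitz u v : `|lslope F u - lslope F v| <= M * `|u - v|.
Proof.
have [w _ ->] := MVT_between v u (lslope_derive F).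
by rewrite normrM ler_wpM2r.
Qed.

Lemma lsum_dist n u v : `|lsum F n u - lsum F n v| <=
  M * \sum_(i < n) `|iter i F u - iter i F v|.
Proof.
rewrite -sumrB; apply: le_trans (ler_norm_sum _ _ _) _.
by rewrite mulr_sumr ler_sum// => i _; exact: lslope_lipschitz.
Qed.

(** F^n has mean slope 1 over a period, so its slope is 1 somewhere. *)
Lemma lsum_zero n : exists x, lsum F n x = 0.
Proof.
have [x _] := MVT_between 0 (0 + 1) (iter_derive F n).
rewrite iterD1 add0r subr0 mulr1 [_ + 1]addrC addrK => e.
by exists x; apply: expR_inj; rewrite expR0 -e.
Qed.

Lemma lsum_denjoy k x y : `|lsum F (cq c k.+1) x - lsum F (cq c k.+1) y| <= 4 * M.
Proof.
(* The slope is not monotone, but adding M t makes it so, with degree M; the correction - d id then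
   removes M t again. *)
have := @denjoy_koksma _ _ c k (fun t => lslope F t + M * t) M x y.
rewrite (eq_bigr (fun i : 'I__ => lslope F (iter i F x))); last by move=> i _; ring.
rewrite [X in `|_ - X|](eq_bigr (fun i : 'I__ => lslope F (iter i F y))); last by move=> i _; ring.
apply; last by move=> t; rewrite lslopeD1; ring.
move=> u v uv; have := lslope_lipschitz u v.
rewrite (distrC u v) (@ger0_norm _ (v - u)) ?subr_ge0// ler_norml => /andP[_]; lra.
Qed.

Lemma denjoy_ineq k x : `|lsum F (cq c k.+1) x| <= 4 * M.
Proof.
have [y hy] := lsum_zero (cq c k.+1).
by have := lsum_denjoy k x y; rewrite hy subr0.
Qed.

Lemma cdisp_iter n k x : exists2 z, between x (cret c k x) z &
  cdisp c k (iter n F x) = expR (lsum F n z) * cdisp c k x.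
Proof.
have [z hz e] := MVT_between x (cret c k x) (iter_derive F n).
by exists z; rewrite // /cdisp -cret_iter e normrM (ger0_norm (expR_ge0 _)).
Qed.

(* The images of [x, T_k x] under F^(q_1), ..., F^(q_k) have disjoint interiors
   and, by [denjoy_ineq], lengths comparable to that of [x, T_k x]. *)
Lemma cdisp_small (e : R) : 0 < e -> exists K, forall k x, (K <= k)%N -> cdisp c k x <= e.
Proof.
move=> e0; pose a := expR (- (4 * M)).
have a0 : 0 < a by exact: expR_gt0.
have sum_ge j k x : j%:R * a * cdisp c k x <= \sum_(i < cq c j.+2) cdisp c k (iter i F x).
  elim: j => [|j ih]; first by rewrite !mul0r; apply: sumr_ge0 => i _; rewrite ltW ?cdisp_gt0.
  rewrite -!(big_mkord xpredT (fun i => cdisp c k (iter i F x))) in ih *.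
  rewrite (big_cat_nat (leq0n _) (cq_ltSS c j))/= big_nat_recr//=.
  have h : 0 <= \sum_((cq c j.+2).+1 <= i < cq c j.+3) cdisp c k (iter i F x).
    by apply: sumr_ge0 => i _; rewrite ltW ?cdisp_gt0.
  have [z _] := cdisp_iter (cq c j.+2) k x.
  have : a <= expR (lsum F (cq c j.+2) z).
    by rewrite ler_expR; have := denjoy_ineq j.+1 z; rewrite ler_norml => /andP[].
  move=> /(ler_wpM2r (ltW (cdisp_gt0 c k x))) h2 h3; rewrite -natr1; lra.
exists (Num.truncn (e * a)^-1).+3 => -[|k] x // Kk.
have h1 := le_trans (sum_ge k k.+1 x) (cdisp_sum x (leqnn _)).
have ea0 : 0 < e * a by exact: mulr_gt0.
have : (e * a)^-1 < k%:R.
  by apply: lt_le_trans (Num.Theory.truncnS_gt _) _; rewrite ler_nat; exact: ltnW Kk.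
rewrite -[_^-1]mul1r ltr_pdivrMr// => h2.
have k0 : 0 < k%:R :> R by rewrite ltr0n; case: (k) Kk.
have h3 : 0 < k%:R * a by exact: mulr_gt0.
by rewrite -(ler_pM2l h3); lra.
Qed.

(** The successive images of the tile have total length at most 1, so the Lipschitz errors of the
    slope add up to at most M. *)
Lemma lsum_tile_dist k n z u v : (n <= cq c k.+1)%N ->
  between z (cret c k z) u -> between z (cret c k z) v ->
  `|lsum F n u - lsum F n v| <= M.
Proof.
move=> nq hu hv; apply: le_trans (lsum_dist _ _ _) _.
rewrite -[leRHS]mulr1 ler_wpM2l//; apply: le_trans (cdisp_sum z nq).
apply: ler_sum => i _; rewrite /cdisp -cret_iter (distrC (iter i F (cret c k z))).
by apply: between_dist; apply: between_homo => // s t; rewrite ler_iter.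
Qed.

(** Up to the factor [expR M], each derivative is the ratio of the length of the image tile to that
    of the tile, and the images have total length at most 1. *)
Lemma expR_lsum_sum k x n : (n <= cq c k.+1)%N ->
  \sum_(i < n) expR (lsum F i x) <= expR M / cdisp c k x.
Proof.
move=> nq; rewrite ler_pdivlMr ?cdisp_gt0// mulr_suml -[leRHS]mulr1.
apply: le_trans (ler_wpM2l (expR_ge0 M) (cdisp_sum x nq)).
rewrite mulr_sumr; apply: ler_sum => i _.
have [z hz ->] := cdisp_iter i k x.
rewrite mulrA ler_wpM2r ?(ltW (cdisp_gt0 _ _ _))// -expRD ler_expR.
have iq : (i <= cq c k.+1)%N by rewrite (leq_trans (ltnW (ltn_ord i))).
have := lsum_tile_dist iq hz (betweenl _ _).
rewrite ler_norml => /andP[]; lra.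
Qed.

End Distortion.

(** * Limits of discrepancies *)

Section Clip.
Context {R : realType}.
Implicit Types (psi : R -> R) (a b t u v K : R).

Definition deg psi := psi 1 - psi 0.

Definition has_degree psi := forall t, psi (t + 1) = psi t + deg psi.

Definition lipschitz_degree psi := has_degree psi /\
  exists2 K, 0 <= K & forall u v, `|psi u - psi v| <= K * `|u - v|.

(* For [psi] of class C^1 this is the integral of [floor (s - b)] against
   [d psi], from [b] to [t]. *)
Definition kern psi b t : R := let n : R := (Num.floor (t - b))%:~R in
  n * (psi t - psi b) - deg psi * (n * (n + 1) / 2).

(* The primitive of the density of [psi] restricted to [a, b] + Z *)
Definition clip psi a b t := kern psi a t - kern psi b t.

Lemma floorD1 t : Num.floor (t + 1) = Num.floor t + 1.
Proof.
apply: Num.Theory.floor_def; have := Num.Theory.floor_itv t.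
rewrite !intrD; lra.
Qed.

Lemma clipD1 psi a b t : has_degree psi ->
  clip psi a b (t + 1) = clip psi a b t + (psi b - psi a).
Proof.
move=> hpsi; rewrite /clip /kern (addrAC t 1 (- a)) (addrAC t 1 (- b)) !floorD1 hpsi !intrD; lra.
Qed.

Lemma clip_unit psi a t : has_degree psi ->
  clip psi a (a + 1) t = psi t - psi a - deg psi.
Proof.
move=> hpsi; rewrite /clip /kern -[t - a](subrK 1) floorD1 hpsi !intrD.
by rewrite (_ : t - (a + 1) = t - a - 1); [lra|ring].
Qed.

(** On each period starting at a, [clip] follows psi up to b and is constant afterwards. *)
Lemma clipE psi a b t : has_degree psi -> a <= b <= a + 1 ->
  let n : R := (Num.floor (t - a))%:~R in
  clip psi a b t = psi (Num.min (t - n) b) - psi b + n * (psi b - psi a).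
Proof.
move=> hpsi ab n.
have psiz m : psi (t - m%:~R) = psi t - m%:~R * deg psi.
  have h := @periodicz R (fun x => psi x - x * deg psi).
  have := h (fun x => ltac:(rewrite hpsi; ring)) t (- m); rewrite mulrNz; lra.
have := Num.Theory.floor_itv (t - a); rewrite intrD -/n => hn.
case: (ltP (t - n) b) => tb.
  rewrite /clip /kern -/n.
  rewrite (_ : Num.floor (t - b) = Num.floor (t - a) - 1); last first.
    by apply: Num.Theory.floor_def; rewrite !(intrD, mulrNz) -/n; lra.
  rewrite intrB -/n psiz -/n; lra.
rewrite /clip /kern -/n.
rewrite (_ : Num.floor (t - b) = Num.floor (t - a)); last first.
  by apply: Num.Theory.floor_def; rewrite intrD -/n; lra.
rewrite -/n; lra.
Qed.

Lemma clip_homo psi a b : has_degree psi -> a <= b <= a + 1 ->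
  (forall u v, a <= u -> u <= v -> v <= b -> psi u <= psi v) ->
  {homo clip psi a b : u v / u <= v}.
Proof.
move=> hpsi ab homo u v uv; rewrite !clipE//.
set n : R := (Num.floor (u - a))%:~R; set m : R := (Num.floor (v - a))%:~R.
have := Num.Theory.floor_itv (u - a); rewrite intrD -/n => hn.
have := Num.Theory.floor_itv (v - a); rewrite intrD -/m => hm.
have pab : psi a <= psi b by apply: homo; lra.
have [e|ne] := eqVneq (Num.floor (u - a)) (Num.floor (v - a)).
  have e' : m = n by rewrite /m /n e.
  rewrite e' lerD2r lerD2r; apply: homo.
  - by rewrite le_min; apply/andP; split; lra.
  - by rewrite le_min !ge_min lexx orbT andbT lerB.
  - by rewrite ge_min lexx orbT.
have nm : n + 1 <= m.
  rewrite /n /m -(intrD _ _ 1) ler_int -ltzD1 ltrD2r lt_neqAle ne.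
  by apply: Num.Theory.le_floor; rewrite lerD2r.
have h1 : psi (Num.min (u - n) b) <= psi b.
  by apply: homo; rewrite ?lexx ?ge_min ?lexx ?orbT// le_min; apply/andP; split; lra.
have h2 : psi a <= psi (Num.min (v - m) b).
  by apply: homo; rewrite ?lexx ?ge_min ?lexx ?orbT// le_min; apply/andP; split; lra.
have : (n + 1) * (psi b - psi a) <= m * (psi b - psi a) by rewrite ler_wpM2r// subr_ge0.
lra.
Qed.

Lemma kern_lin psi1 psi2 al be b t :
  kern (fun x => al * psi1 x + be * psi2 x) b t = al * kern psi1 b t + be * kern psi2 b t.
Proof. by rewrite /kern /deg; field. Qed.

Lemma clip_lin psi1 psi2 al be a b t :
  clip (fun x => al * psi1 x + be * psi2 x) a b t = al * clip psi1 a b t + be * clip psi2 a b t.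
Proof. by rewrite /clip !kern_lin; ring. Qed.

Lemma has_degree_id : has_degree id.
Proof. by move=> t; rewrite /deg subr0. Qed.

(** By monotonicity rather than by cases: K id + s psi is nondecreasing for |s| <= 1, hence so is
    its [clip]. The part K clip(id) has slope at most K because the clip to the complementary arc
    [b, a + 1] is nondecreasing as well. *)
Lemma clip_lipschitz psi K a b : has_degree psi -> 0 <= K ->
  (forall u v, `|psi u - psi v| <= K * `|u - v|) -> a <= b <= a + 1 ->
  forall u v, `|clip psi a b u - clip psi a b v| <= K * `|u - v|.
Proof.
move=> hpsi K0 hK ab.
have cid a' b' : a' <= b' <= a' + 1 -> {homo clip id a' b' : u v / u <= v}.
  by move=> ?; apply: clip_homo => //; exact: has_degree_id.
have key s u v : `|s| <= 1 -> u <= v -> s * (clip psi a b u - clip psi a b v) <= K * (v - u).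
  move=> s1 uv.
  have h : {homo clip (fun x => K * x + s * psi x) a b : u v / u <= v}.
    apply: clip_homo => //.
      by move=> t; rewrite /deg hpsi /deg; ring.
    move=> x y _ xy _; have := hK x y.
    rewrite (distrC x) (@ger0_norm _ (y - x)) ?subr_ge0// => h.
    have : `|s * (psi x - psi y)| <= K * (y - x).
      rewrite normrM -[leRHS]mul1r; apply: ler_pM => //.
    rewrite ler_norml => /andP[]; lra.
  have h1 := h _ _ uv; rewrite !(clip_lin id) in h1.
  have ab' : b <= a + 1 <= b + 1 by lra.
  have h2 := cid _ _ ab' _ _ uv.
  have e t : clip id b (a + 1) t = t - a - 1 - clip id a b t.
    have := clip_unit a t has_degree_id; rewrite /clip /deg subr0 /=; lra.
  rewrite !e in h2.
  have : K * (clip id a b v - clip id a b u) <= K * (v - u) by rewrite ler_wpM2l//; lra.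
  lra.
move=> u v; wlog uv : u v / u <= v.
  move=> w; case/orP: (le_total u v) => uv; first exact: w.
  by rewrite distrC (distrC u) w.
rewrite (distrC u v) (@ger0_norm _ (v - u)) ?subr_ge0// ler_norml.
have h1 := @key 1 u v; have h2 := @key (-1) u v.
rewrite normr1 lexx in h1; rewrite normrN1 lexx in h2.
have {}h1 := h1 isT uv; have {}h2 := h2 isT uv.
by apply/andP; split; lra.
Qed.

(** F is increasing and commutes with integer translations, so it preserves the integer parts of
    differences. *)
Lemma clip_lmap (F : free_lift R) psi a b t : has_degree psi ->
  clip psi (F a) (F b) (F t) = clip (psi \o F) a b t.
Proof.
move=> hpsi; have F0 : deg (psi \o F) = deg psi.
  by rewrite /deg /= -[X in F X]add0r lmapD1 hpsi /deg; ring.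
rewrite /clip /kern F0 /=.
have fl x : Num.floor (F t - F x) = Num.floor (t - x).
  apply: Num.Theory.floor_def; have := Num.Theory.floor_itv (t - x).
  rewrite !intrD => h.
  have h1 := iterDz F 1 x (Num.floor (t - x)); have h2 := lmapD1 F (x + (Num.floor (t - x))%:~R).
  rewrite /= in h1.
  have h3 : F (x + (Num.floor (t - x))%:~R) <= F t by rewrite (ler_iter F 1); lra.
  have h4 : F t < F (x + (Num.floor (t - x))%:~R + 1) by rewrite ltr_lmap; lra.
  rewrite h2 h1 in h4; rewrite h1 in h3; lra.
by rewrite !fl.
Qed.

Lemma has_degree_comp (F : free_lift R) psi : has_degree psi -> has_degree (psi \o F).
Proof.
move=> h t; have F1 : F 1 = F 0 + 1 by rewrite -lmapD1 add0r.
by rewrite /deg /= lmapD1 F1 !h; ring.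
Qed.

Lemma unit_homo (W : R -> R) : (forall a b, a <= b <= a + 1 -> W a <= W b) ->
  {homo W : u v / u <= v}.
Proof.
move=> h u v uv.
have key n a b : a <= b -> b <= a + n%:R -> W a <= W b.
  elim: n a b => [|n ih] a b ab bn.
    by rewrite addr0 in bn; have -> : a = b by lra.
  have [b1|b1] := leP b (a + 1); first by apply: h; lra.
  apply: (@le_trans _ _ (W (a + 1))); first by apply: h; lra.
  by apply: ih; [exact: ltW|move: bn; rewrite -natr1; lra].
apply: (key (Num.truncn (v - u)).+1) => //.
have := Num.Theory.truncnS_gt (v - u); lra.
Qed.

(** An ultrafilter gives limits for all psi, a and b at once, without extracting subsequences. *)
Lemma ultra_bounded_cvg (G : set_system nat) {UG : UltraFilter G} (w : nat -> R) (B : R) :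
  (forall k, `|w k| <= B) -> cvg (w @ G).
Proof.
move=> hw.
have [|x [_ xcl]] := @segment_compact R (- B) B (w @ G) _.
  apply: (@filterS _ G _ setT); last exact: filterT.
  by move=> k _; have := hw k; rewrite ler_norml /= in_itv.
apply/cvg_ex; exists x => N xN.
have [//|h] := in_ultra_setVsetC (w @^-1` N) UG.
by have [y [] //] := xcl (~` N) N h xN.
Qed.

End Clip.

(** * The limit density and its invariance *)

Section LimitDiscrepancy.
Context {R : realType} (F : free_lift R) (c : convergents F) (M : R).
Hypothesis dlslope_le : forall x, `|dlslope F x| <= M.
Context (xs ys : nat -> R) (G : set_system nat) {UG : UltraFilter G}.
Hypothesis oo_le_G : (\oo : set_system nat) `<=` G.
Implicit Types (psi : R -> R) (a b t u v : R) (k n i : nat).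

(** The subtracted multiple of [iter i F t] makes the summand periodic and gives it the form
    required by [denjoy_koksma]. *)
Definition psum k psi a b t : R :=
  \sum_(i < cq c k.+1) (clip psi a b (iter i F t) - (psi b - psi a) * iter i F t).

Definition incr psi a b k : R := psum k psi a b (xs k) - psum k psi a b (ys k).

(* The integral of [d psi] over [a, b] against the limit of the signed counting
   densities of the two orbit segments, normalised to total mass 0 *)
Definition disc psi a b : R := lim (incr psi a b @ G).

Lemma incr_add psi a b e k : incr psi a b k + incr psi b e k = incr psi a e k.
Proof.
have h t : psum k psi a b t + psum k psi b e t = psum k psi a e t.
  by rewrite -big_split; apply: eq_bigr => i _ /=; rewrite /clip; ring.
rewrite /incr -!h; ring.
Qed.

Lemma incr_lin psi1 psi2 al be a b k :
  incr (fun x => al * psi1 x + be * psi2 x) a b k =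
  al * incr psi1 a b k + be * incr psi2 a b k.
Proof.
have h t : psum k (fun x => al * psi1 x + be * psi2 x) a b t =
    al * psum k psi1 a b t + be * psum k psi2 a b t.
  by rewrite !mulr_sumr -big_split; apply: eq_bigr => i _; rewrite clip_lin /=; ring.
rewrite /incr !h; ring.
Qed.

Lemma incr_homo_le psi a b k : has_degree psi -> a <= b <= a + 1 ->
  (forall u v, a <= u -> u <= v -> v <= b -> psi u <= psi v) ->
  `|incr psi a b k| <= 4 * (psi b - psi a).
Proof.
move=> hpsi ab homo; apply: denjoy_koksma; first exact: clip_homo.
by move=> t; rewrite clipD1.
Qed.

Lemma incr_lipschitz psi K a b k : has_degree psi -> 0 <= K ->
  (forall u v, `|psi u - psi v| <= K * `|u - v|) ->
  `|incr psi a b k| <= 12 * K * `|b - a|.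
Proof.
move=> hpsi K0 hK.
(* 12 = 8 + 4: psi + K id is nondecreasing with increment at most 2 K (v - u), which [incr_homo_le]
   multiplies by 4, and removing K id costs 4 K (v - u). *)
have loc u v : u <= v <= u + 1 -> `|incr psi u v k| <= 12 * K * (v - u).
  move=> uv.
  have h1 := @incr_homo_le (fun x => 1 * psi x + K * id x) u v k _ uv.
  have h2 := @incr_homo_le id u v k (@has_degree_id R) uv (fun _ _ _ h _ => h).
  rewrite incr_lin in h1.
  have {}h1 := h1 _ _.
  have h3 : psi v - psi u <= K * (v - u).
    have := hK v u; rewrite (@ger0_norm _ (v - u)); last lra.
    by rewrite ler_norml => /andP[].
  have : `|1 * incr psi u v k + K * incr id u v k| <=
    4 * (1 * psi v + K * id v - (1 * psi u + K * id u)).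
    apply: h1 => [t|s t _ st _]; first by rewrite /deg hpsi /deg /=; ring.
    have := hK s t; rewrite (distrC s t) (@ger0_norm _ (t - s)) ?subr_ge0//.
    rewrite ler_norml /= => /andP[_]; lra.
  have : `|K * incr id u v k| <= K * (4 * (v - u)).
    by rewrite normrM (ger0_norm K0) ler_wpM2l.
  rewrite !ler_norml /= => /andP[a1 a2] /andP[b1 b2]; apply/andP; split; lra.
have key s u v : `|s| <= 1 -> u <= v -> s * incr psi u v k <= 12 * K * (v - u).
  move=> s1 uv.
  have h := @unit_homo _ (fun t => 12 * K * t - s * incr psi u t k) _ u v uv.
  suff : 12 * K * u - s * incr psi u u k <= 12 * K * v - s * incr psi u v k.
    have := incr_add psi u u u k; move=> e0; have -> : incr psi u u k = 0 by lra.
    lra.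
  apply: h => a' b' ab'; rewrite -(incr_add psi u a' b' k).
  have : `|s * incr psi a' b' k| <= 12 * K * (b' - a').
    rewrite normrM -[leRHS]mul1r; apply: ler_pM => //; exact: loc.
  rewrite ler_norml => /andP[]; lra.
wlog ab : a b / a <= b.
  move=> w; case/orP: (le_total a b) => ab; first exact: w.
  rewrite (distrC b a); have := w b a ab.
  have := incr_add psi a b a k; have := incr_add psi a a a k => e0 e1.
  have -> : incr psi a b k = - incr psi b a k by lra.
  by rewrite normrN.
rewrite (@ger0_norm _ (b - a)) ?subr_ge0// ler_norml.
have h1 := @key 1 a b; have h2 := @key (-1) a b.
rewrite normr1 lexx in h1; rewrite normrN1 lexx in h2.
have {}h1 := h1 isT ab; have {}h2 := h2 isT ab.
by apply/andP; split; lra.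
Qed.

Lemma disc_cvg psi a b : lipschitz_degree psi -> incr psi a b @ G --> disc psi a b.
Proof.
move=> [hpsi [K K0 hK]].
by have /cvgP := @ultra_bounded_cvg _ G UG (incr psi a b) _ (fun k => incr_lipschitz a b k hpsi K0 hK).
Qed.

Lemma disc_eq psi a b (w : nat -> R) (l : R) : incr psi a b =1 w -> w @ G --> l -> disc psi a b = l.
Proof. by move=> /funext e h; rewrite /disc e; exact: cvg_lim. Qed.

Lemma disc_add psi a b e : lipschitz_degree psi ->
  disc psi a b + disc psi b e = disc psi a e.
Proof.
move=> h; apply/esym/(disc_eq (w := incr psi a b + incr psi b e)).
  by move=> k; rewrite -(incr_add psi a b).
by apply: cvgD; exact: disc_cvg.
Qed.

Lemma disc_lin psi1 psi2 al be a b : lipschitz_degree psi1 -> lipschitz_degree psi2 ->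
  disc (fun x => al * psi1 x + be * psi2 x) a b = al * disc psi1 a b + be * disc psi2 a b.
Proof.
move=> h1 h2; apply: (disc_eq (w := cst al * incr psi1 a b + cst be * incr psi2 a b)).
  by move=> k; rewrite incr_lin.
by apply: cvgD; apply: cvgM; (exact: cvg_cst || exact: disc_cvg).
Qed.

Lemma disc_homo_le psi a b : lipschitz_degree psi -> a <= b <= a + 1 ->
  (forall u v, a <= u -> u <= v -> v <= b -> psi u <= psi v) ->
  `|disc psi a b| <= 4 * (psi b - psi a).
Proof.
move=> h ab homo.
have hc : cvg (incr psi a b @ G) by apply/cvg_ex; exists (disc psi a b); exact: disc_cvg.
have hk k : `|incr psi a b k| <= 4 * (psi b - psi a) by apply: incr_homo_le => //; case: h.
rewrite ler_norml; apply/andP; split.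
  apply: limr_ge => //; apply: (@filterS _ G _ setT) filterT => k _.
  by have := hk k; rewrite ler_norml => /andP[].
apply: limr_le => //; apply: (@filterS _ G _ setT) filterT => k _.
by have := hk k; rewrite ler_norml => /andP[].
Qed.

Lemma lipschitz_degree_id : lipschitz_degree (@id R).
Proof. by split; [exact: has_degree_id|exists 1 => // u v; rewrite mul1r]. Qed.

Lemma lipschitz_degree_lin psi1 psi2 al be :
  lipschitz_degree psi1 -> lipschitz_degree psi2 ->
  lipschitz_degree (fun x => al * psi1 x + be * psi2 x).
Proof.
move=> [d1 [K1 K10 h1]] [d2 [K2 K20 h2]]; split.
  by move=> t; rewrite d1 d2 /deg; ring.
exists (`|al| * K1 + `|be| * K2); first by rewrite addr_ge0// mulr_ge0.
move=> u v.
rewrite (_ : _ - _ = al * (psi1 u - psi1 v) + be * (psi2 u - psi2 v)); last by ring.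
apply: le_trans (ler_normD _ _) _; rewrite !normrM mulrDl -!mulrA.
by apply: lerD; apply: ler_wpM2l => //.
Qed.

Lemma lmap_lipschitz : exists2 K, 0 <= K & forall u v, `|F u - F v| <= K * `|u - v|.
Proof.
have [|K K0 hK] := @periodic_continuous_bounded R (fun x => expR (lslope F x)) _ (fun x => congr1 expR (lslopeD1 F x)).
  move=> x; apply: continuous_comp; last exact: continuous_expR.
  exact: is_derive_continuous (lslope_derive F x).
exists K => // u v; have [z _ ->] := MVT_between v u (lmap_derive F).
by rewrite normrM ler_wpM2r.
Qed.

Lemma lipschitz_degree_comp psi : lipschitz_degree psi -> lipschitz_degree (psi \o F).
Proof.
move=> [d [K K0 hK]]; split; first exact: has_degree_comp.
have [L L0 hL] := lmap_lipschitz.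
exists (K * L); first exact: mulr_ge0.
by move=> u v; apply: le_trans (hK _ _) _; rewrite -mulrA ler_wpM2l.
Qed.

(** By [clip_lmap] the two sums differ by one shift of the index, so they telescope to boundary
    terms at t and T_(k+1) t, which merge in the limit by [cdisp_small]. The term with [cp] is the
    same for [xs] and [ys] and cancels. *)
Lemma disc_lmap psi a b : lipschitz_degree psi -> a <= b <= a + 1 ->
  disc psi (F a) (F b) = disc (psi \o F) a b.
Proof.
move=> h ab; have [hd [K K0 hK]] := h.
have Fab : F a <= F b <= F a + 1 by rewrite -lmapD1 !(ler_iter F 1).
pose D := psi (F b) - psi (F a).
pose chi t := clip psi (F a) (F b) t - D * t.
have chi1 t : chi (t + 1) = chi t by rewrite /chi clipD1// /D; ring.
have chi_lip u v : `|chi u - chi v| <= (K + `|D|) * `|u - v|.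
  rewrite (_ : chi u - chi v = (clip psi (F a) (F b) u - clip psi (F a) (F b) v) - D * (u - v)); last by rewrite /chi; ring.
  apply: le_trans (ler_normB _ _) _; rewrite normrM mulrDl lerD//.
  exact: clip_lipschitz.
have e k t : psum k psi (F a) (F b) t - psum k (psi \o F) a b t =
    chi t - chi (cret c k.+1 t) - D * (cret c k.+1 t - t) - D * (cp c k.+1)%:~R.
  rewrite /cret /ret -mulrNz (periodicz chi1) mulrNz.
  rewrite /psum; elim: (cq c k.+1) => [|q ih]; first by rewrite !big_ord0 /=; ring.
  rewrite !big_ord_recr /= -clip_lmap//.
  move: ih; rewrite /chi /= -/D; lra.
have K'0 : 0 <= 2 * (K + `|D| + `|D|) by rewrite mulr_ge0// !addr_ge0.
have diff k (eps : R) : (forall x, cdisp c k.+1 x <= eps) ->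
    `|incr psi (F a) (F b) k - incr (psi \o F) a b k| <= 2 * (K + `|D| + `|D|) * eps.
  move=> heps.
  have bd t : `|chi t - chi (cret c k.+1 t) - D * (cret c k.+1 t - t)| <= (K + `|D| + `|D|) * eps.
    apply: le_trans (ler_normB _ _) _; rewrite normrM [leRHS]mulrDl; apply: lerD.
      apply: le_trans (chi_lip _ _) _; rewrite ler_wpM2l ?addr_ge0// distrC; exact: heps.
    by rewrite ler_wpM2l//; exact: heps.
  rewrite (_ : _ - _ = (psum k psi (F a) (F b) (xs k) - psum k (psi \o F) a b (xs k)) -
     (psum k psi (F a) (F b) (ys k) - psum k (psi \o F) a b (ys k))); last by rewrite /incr; ring.
  rewrite !e; have := bd (xs k); have := bd (ys k).
  rewrite !ler_norml => /andP[a1 a2] /andP[b1 b2]; apply/andP; split; lra.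
apply/eqP; rewrite -subr_eq0; apply/eqP.
have l1 := cvgB (@disc_cvg psi (F a) (F b) h) (@disc_cvg _ a b (lipschitz_degree_comp h)).
have l2 : (incr psi (F a) (F b) - incr (psi \o F) a b) @ G --> (0 : R).
  apply/cvgrPdist_le => eps eps0.
  have e0 : 0 < eps / (2 * (K + `|D| + `|D|) + 1) by apply: divr_gt0 => //; lra.
  have [N hN] := cdisp_small c dlslope_le e0.
  apply: oo_le_G; exists N => // k Nk.
  rewrite sub0r normrN /=.
  apply: le_trans (diff k _ (fun x => hN k.+1 x (leqW Nk))) _.
  rewrite mulrA ler_pdivrMr; last lra.
  rewrite mulrC; apply: ler_wpM2l; first exact: ltW.
  lra.
exact: cvg_unique (l1 _) l2.
Qed.

End LimitDiscrepancy.

(** * Vanishing of the limit density *)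

Section Ergodicity.
Context {R : realType} (F : free_lift R) (c : convergents F) (M : R).
Hypothesis dlslope_le : forall x, `|dlslope F x| <= M.
Context (xs ys : nat -> R) (G : set_system nat) {UG : UltraFilter G}.
Hypothesis oo_le_G : (\oo : set_system nat) `<=` G.
Implicit Types (psi : R -> R) (a b t u v x y p : R) (k n i : nat).

Let U := disc c xs ys G.

Let Uid_le a b : a <= b <= a + 1 -> `|U id a b| <= 4 * (b - a).
Proof. by move=> ab; apply: disc_homo_le => //; exact: lipschitz_degree_id. Qed.

Lemma disc_id_unit a : disc c xs ys G id a (a + 1) = 0.
Proof.
apply: (@disc_eq _ _ c xs ys G UG id a (a + 1) (cst 0)); last exact: cvg_cst.
move=> k; have e t : psum c k id a (a + 1) t = \sum_(i < cq c k.+1) (- a - 1).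
  by apply: eq_bigr => i _; rewrite (clip_unit _ _ (@has_degree_id R)) /deg /=; ring.
by rewrite /incr !e subrr.
Qed.

(** A density bounded by p, integrated against a nonnegative derivative. As [disc] is only an
    interval function, the proof is a Riemann sum: on short intervals psi is replaced by its linear
    part. *)
Lemma disc_le_homo psi dpsi a b p : lipschitz_degree psi ->
  (forall x, is_derive x 1 psi (dpsi x)) -> uniformly_continuous dpsi ->
  0 <= p -> (forall u v, u <= v <= u + 1 -> U id u v <= p * (v - u)) ->
  a <= b <= a + 1 -> (forall x, a <= x <= b -> 0 <= dpsi x) ->
  U psi a b <= p * (psi b - psi a).
Proof.
move=> hpsi dpsiE dpsi_uc p0 hp ab dpsi0.
(* eta bounds the oscillation of [dpsi] on a short interval and s is its value at the left end. The
   remainder psi + (eta - s) id costs 8 eta by [disc_homo_le], eta id costs 4 eta, and replacing s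
   (v - u) by the increment of psi costs p eta. *)
suff main (eta : R) : 0 < eta -> U psi a b <= p * (psi b - psi a) + (p + 12) * eta * (b - a).
  apply/ler_addgt0Pr => e e0.
  have k0 : 0 < (p + 12) * (b - a) + 1.
    by rewrite ltr_wpDl// mulr_ge0//; lra.
  have := main (e / ((p + 12) * (b - a) + 1)) (divr_gt0 e0 k0).
  have : (p + 12) * (e / ((p + 12) * (b - a) + 1)) * (b - a) <= e.
    rewrite mulrAC mulrA ler_pdivrMr// mulrC ler_wpM2l ?ltW//; lra.
  lra.
move=> eta0; have [d d0 hd] := dpsi_uc _ eta0.
have local u v : a <= u -> u <= v -> v <= b -> v - u <= d ->
    U psi u v <= p * (psi v - psi u) + (p + 12) * eta * (v - u).
  move=> au uv vb uvd; have uv1 : u <= v <= u + 1 by lra.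
  pose s := dpsi u; have s0 : 0 <= s by apply: dpsi0; lra.
  have dnear x : u <= x <= v -> `|dpsi x - s| <= eta.
    by move=> ux; apply: hd; rewrite ger0_norm; lra.
  have inc : psi v - psi u >= (s - eta) * (v - u) /\ psi v - psi u <= (s + eta) * (v - u).
    have [x + ->] := MVT_between u v dpsiE.
    move=> hx; have {}hx : u <= x <= v by case/orP: hx; lra.
    have := dnear x hx; rewrite ler_norml => /andP[h1 h2].
    by split; apply: ler_wpM2r; lra.
  have idd := @lipschitz_degree_id R.
  have e := @disc_lin _ _ c xs ys G UG psi id 1 (eta - s) u v hpsi idd.
  have h := @disc_homo_le _ _ c xs ys G UG _ u v (lipschitz_degree_lin 1 (eta - s) hpsi idd) uv1.
  have {}h := h _; rewrite e in h.
  have {}h : `|1 * U psi u v + (eta - s) * U id u v| <=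
      4 * (1 * psi v + (eta - s) * id v - (1 * psi u + (eta - s) * id u)).
    apply: h => x y ux xy yv.
    have [z + ] := MVT_between x y dpsiE; move=> hz hxy.
    have {}hz : u <= z <= v by case/orP: hz; lra.
    have : (s - eta) * (y - x) <= dpsi z * (y - x).
      by apply: ler_wpM2r; [lra|have := dnear z hz; rewrite ler_norml => /andP[]; lra].
    lra.
  move: h; rewrite ler_norml /= => /andP[_ h].
  have := hp _ _ uv1 => /(ler_wpM2l s0) h1.
  have := Uid_le uv1; rewrite ler_norml => /andP[/(ler_wpM2l (ltW eta0)) h2 _].
  have h3 : p * ((s - eta) * (v - u)) <= p * (psi v - psi u).
    by apply: ler_wpM2l => //; case: inc.
  have [_ h4] := inc.
  move: h1 h2 h3 h; lra.
have chain n u v : a <= u -> u <= v -> v <= b -> v - u <= n%:R * d ->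
    U psi u v <= p * (psi v - psi u) + (p + 12) * eta * (v - u).
  elim: n u v => [|n ih] u v au uv vb uvn.
    by rewrite mul0r in uvn; apply: local => //; lra.
  have [h|h] := leP (v - u) d; first exact: local.
  have h1 := @local u (u + d); have h2 := ih (u + d) v.
  have e := @disc_add _ _ c xs ys G UG psi u (u + d) v hpsi.
  rewrite -[U _ _ _]e.
  have {}h1 := h1 au; have {}h2 : U psi (u + d) v <=
     p * (psi v - psi (u + d)) + (p + 12) * eta * (v - (u + d)).
    by apply: h2; rewrite -?natr1 in uvn *; lra.
  have {}h1 : U psi u (u + d) <= p * (psi (u + d) - psi u) + (p + 12) * eta * (u + d - u).
    by apply: h1; lra.
  rewrite /U in h1 h2; lra.
apply: (chain (Num.truncn ((b - a) / d)).+1) => //; try lra.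
by rewrite -ler_pdivrMr// ltW// Num.Theory.truncnS_gt.
Qed.

Lemma disc_iter psi m a b : lipschitz_degree psi -> a <= b <= a + 1 ->
  U psi (iter m F a) (iter m F b) = U (psi \o iter m F) a b.
Proof.
move=> h ab; elim: m psi h => [|m ih] psi h //=.
rewrite /U (disc_lmap c dlslope_le xs ys oo_le_G)//; last by rewrite -iterD1 !ler_iter.
exact: ih (lipschitz_degree_comp F h).
Qed.

(** The longer range is needed because the covering in [disc_id_le0] uses images of one tile of
    every order below q_(k+1) + q_k. *)
Lemma lsum_tile_dist2 k z u v n : (n <= cq c k.+1 + cq c k)%N ->
  between z (cret c k z) u -> between z (cret c k z) v ->
  `|lsum F n u - lsum F n v| <= M + M.
Proof.
move=> nq hu hv; have M0 : 0 <= M := le_trans (normr_ge0 _) (dlslope_le 0).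
have [h|/ltnW h] := leqP n (cq c k.+1).
  by apply: le_trans (lsum_tile_dist dlslope_le h hu hv) _; lra.
rewrite -(subnKC h) !lsumD.
have h1 := lsum_tile_dist dlslope_le (leqnn _) hu hv.
have h2 : (n - cq c k.+1 <= cq c k.+1)%N.
  by rewrite leq_subLR (leq_trans nq)// leq_add2l cq_leS.
have bi w : between z (cret c k z) w -> between (iter (cq c k.+1) F z)
    (cret c k (iter (cq c k.+1) F z)) (iter (cq c k.+1) F w).
  by rewrite -cret_iter; apply: between_homo => s t; rewrite ler_iter.
have h3 := lsum_tile_dist dlslope_le h2 (bi _ hu) (bi _ hv).
move: h1 h3; rewrite !ler_norml => /andP[? ?] /andP[? ?]; apply/andP; split; lra.
Qed.

Lemma iter_expR_uc n : uniformly_continuous (fun x => expR (lsum F n x)).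
Proof.
apply: periodic_uniformly_continuous; last by move=> x; rewrite lsumD1.
move=> x; apply: continuous_comp; last exact: continuous_expR.
exact: is_derive_continuous (lsum_derive F n x).
Qed.

Lemma iter_lipschitz_degree n : lipschitz_degree (iter n F).
Proof.
elim: n => [|n ih]; first exact: lipschitz_degree_id.
have := lipschitz_degree_comp F ih; congr lipschitz_degree.
by apply/funext => x; rewrite /= -iterSr.
Qed.

(* [p] is the supremum of the density of the limit measure, and [W] the
   distribution function of the defect. *)
Lemma disc_id_le0 a b : a <= b <= a + 1 -> U id a b <= 0.
Proof.
pose S := [set r | exists a b, [/\ a < b, b <= a + 1 & r = U id a b / (b - a)]].
have S0 : S 0.
  by exists 0, (0 + 1); split; rewrite /U ?disc_id_unit ?mul0r// add0r ltr01.
have Sub : ubound S 4.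
  move=> _ [u [v [uv vu ->]]]; rewrite ler_pdivrMr ?subr_gt0//.
  have uv1 : u <= v <= u + 1 by lra.
  by have := Uid_le uv1; rewrite ler_norml => /andP[].
have Ssup : has_sup S by split; [exists 0|exists 4].
pose p := sup S.
have p0 : 0 <= p by apply: ub_le_sup S0; exists 4.
have hp u v : u <= v <= u + 1 -> U id u v <= p * (v - u).
  move=> uv; have [e|ne] := eqVneq u v.
    rewrite -e subrr mulr0.
    have uu : u <= u <= u + 1 by lra.
    by have := Uid_le uu; rewrite subrr mulr0 ler_norml => /andP[].
  have uv' : u < v by rewrite lt_neqAle ne; case/andP: uv.
  rewrite -ler_pdivrMr ?subr_gt0//; apply: ub_le_sup; first by exists 4.
  by exists u, v; split=> //; case/andP: uv.
have Uadd u v w : U id u v + U id v w = U id u w.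
  by apply: disc_add; exact: lipschitz_degree_id.
suff p_le0 : p <= 0.
  move=> ab; apply: le_trans (hp _ _ ab) _.
  by rewrite mulr_le0_ge0//; lra.
rewrite leNgt; apply/negP => pp.
pose W (t : R) : R := p * t - U id 0 t.
have WE u v : W v - W u = p * (v - u) - U id u v.
  by rewrite /W; have := Uadd 0 u v; lra.
have Whomo : {homo W : u v / u <= v}.
  by apply: unit_homo => u v uv; rewrite -subr_ge0 WE subr_ge0 hp.
have W1 t : W (t + 1) = W t + p.
  by have := WE t (t + 1); rewrite /U disc_id_unit; lra.
pose E := expR (M + M); have E0 : 0 < E := expR_gt0 _.
(* With this e each of the two families of tiles carries a defect of at most 2 e E = p / 4, whereas
   together they must carry p. *)
pose e : R := p / (8 * E); have e0 : 0 < e by rewrite divr_gt0// mulr_gt0.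
(* On [u, v] the mean defect is below e. If it were at least 2 e on every tile, the tiles stepping
   from u within [u, v], which fill at least half of it, would already carry e (v - u). An odd k
   makes T_k move to the right. *)
have [k [y [kright hy]]] : exists k y, (forall x, x < cret c k x) /\
    W (cret c k y) - W y <= 2 * e * (cret c k y - y).
  have [_ [u [v [uv vu ->]]]] : exists2 r, S r & p - e < r by exact: sup_adherent.
  rewrite ltr_pdivlMr ?subr_gt0// => near_max.
  have hWuv : W v - W u < e * (v - u) by rewrite WE; lra.
  have vu0 : 0 < (v - u) / 2 by lra.
  have [K hK] := cdisp_small c dlslope_le vu0.
  pose k := (K.*2).+1.
  have kr x : x < cret c k x.
    have := ret_side c k x; rewrite -/(cret c k x) -signr_odd /= odd_double expr1; lra.
  exists k; apply: contrapT => hno.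
  have big y : 2 * e * (cret c k y - y) <= W (cret c k y) - W y.
    by rewrite leNgt; apply/negP => h; apply: hno; exists y; split => //; exact: ltW.
  have bign j : 2 * e * (iter j (cret c k) u - u) <= W (iter j (cret c k) u) - W u.
    elim: j => [|j ih] /=; first by rewrite !subrr mulr0.
    have := big (iter j (cret c k) u); lra.
  have [q0 q00 hq0] : exists2 q0, 0 < q0 & forall x, q0 <= 1 * (cret c k x - x).
    by apply: ret_displacement => x; have := kr x; rewrite /cret; lra.
  have ex : exists j, v < iter j (cret c k) u.
    exists (Num.truncn ((v - u) / q0)).+1.
    have := Num.Theory.truncnS_gt ((v - u) / q0).
    rewrite ltr_pdivrMr//.
    have h j : j%:R * q0 <= iter j (cret c k) u - u.
      elim: j => [|j ih]; first by rewrite mul0r subrr.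
      rewrite -natr1 /=; have := hq0 (iter j (cret c k) u); lra.
    have := h (Num.truncn ((v - u) / q0)).+1; lra.
  case: (ex_minnP ex) => [[|j]] /= hj hmin; first by lra.
  have hj1 : iter j (cret c k) u <= v.
    by rewrite leNgt; apply/negP => /hmin; rewrite ltnn.
  have : cdisp c k (iter j (cret c k) u) <= (v - u) / 2.
    by apply: hK; rewrite /k -addnn; lia.
  rewrite /cdisp ger0_norm; last by have := kr (iter j (cret c k) u); lra.
  move=> h1; have h2 := bign j; have h3 := Whomo _ _ hj1.
  have : 0 <= e * (2 * (iter j (cret c k) u - u) - (v - u)).
    by apply: mulr_ge0; [exact: ltW|lra].
  lra.
pose dW m : R := W (iter m F (cret c k y)) - W (iter m F y).
have yT := kright y.
have yT1 : y <= cret c k y <= y + 1.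
  have := cdisp_sum y (cq_gt0 c k); rewrite big_ord1 /cdisp.
  by rewrite ger0_norm /=; lra.
have Fmono m : 0 <= dW m by rewrite subr_ge0; apply: Whomo; rewrite ler_iter ltW.
have dW_le m : (m <= cq c k.+1 + cq c k)%N ->
    dW m <= 2 * e * E * cdisp c k (iter m F y).
  move=> mq.
  have [z0 hz0 ez0] := MVT_between y (cret c k y) (iter_derive F m).
  (* By bounded distortion C dominates the slope of F^m on the tile, so C id - F^m is nondecreasing
     there, and [disc_le_homo] bounds the defect of the image by C times that of the tile. *)
  pose C : R := E * expR (lsum F m z0).
  have idd := @lipschitz_degree_id R.
  have hder x : is_derive x 1 (fun x => C * id x + -1 * iter m F x) (C + -1 * expR (lsum F m x)).
    have d1 : is_derive x 1 (fun x => C * id x) C.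
      by rewrite -[C in is_derive _ _ _ C]mulr1; apply: is_deriveZ.
    have d2 : is_derive x 1 (fun x => -1 * iter m F x) (-1 * expR (lsum F m x)).
      by have := iter_derive F m x => ?; apply: is_deriveZ.
    exact: is_deriveD.
  have huc : uniformly_continuous (fun x => C + -1 * expR (lsum F m x)).
    move=> eps /(iter_expR_uc m)[d d0 hd]; exists d => // u v /hd.
    by rewrite (_ : C + _ - _ = - (expR (lsum F m u) - expR (lsum F m v))) ?normrN//; ring.
  have hpos x : y <= x <= cret c k y -> 0 <= C + -1 * expR (lsum F m x).
    move=> hx; rewrite mulN1r subr_ge0 /C -expRD ler_expR.
    have bx : between y (cret c k y) x by rewrite /between hx.
    have := lsum_tile_dist2 mq bx hz0; rewrite ler_norml => /andP[]; lra.
  have := disc_le_homo (lipschitz_degree_lin C (-1) idd (iter_lipschitz_degree m)) hder huc p0 hp yT1 hpos.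
  rewrite /U disc_lin//; last exact: iter_lipschitz_degree.
  have := disc_iter m idd yT1; rewrite /U /= => <-.
  rewrite -/U => h.
  have dWE : dW m = p * (iter m F (cret c k y) - iter m F y) - U id (iter m F y) (iter m F (cret c k y)).
    by rewrite /dW WE.
  have h1 : dW m <= C * (W (cret c k y) - W y) by rewrite dWE WE; lra.
  apply: le_trans h1 _.
  have C0 : 0 <= C by rewrite mulr_ge0 ?expR_ge0.
  apply: le_trans (ler_wpM2l C0 hy) _.
  rewrite /cdisp -cret_iter ez0 normrM (ger0_norm (expR_ge0 _)).
  rewrite (@ger0_norm _ (cret c k y - y)); last by rewrite subr_ge0 ltW.
  by rewrite /C le_eqVlt; apply/orP; left; apply/eqP; ring.
(* The tiling is based at T_k y instead of y: [T_k y, T_k T_k y] is the image of [y, T_k y] under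
   F^(q_k) up to an integer, and [T_k y, T_(k+1) T_k y] lies inside [y, T_k y]. Images of the single
   good tile thus cover everything. *)
have := tile_dist c k (cret c k y) Whomo W1.
have s1 : \sum_(i < cq c k.+1) `|W (iter i F (cret c k (cret c k y))) - W (iter i F (cret c k y))| <= 2 * e * E.
  rewrite -[leRHS]mulr1.
  have eE : 0 <= 2 * e * E by do 2![apply: mulr_ge0; last exact: ltW].
  apply: le_trans (ler_wpM2l eE (cdisp_sum (iter (cq c k) F y) (leqnn (cq c k.+1)))).
  rewrite mulr_sumr; apply: ler_sum => i _.
  have Wz t (m : int) : W (t - m%:~R) = W t - m%:~R * p.
    rewrite -mulrNz; have h := periodicz (f := fun x => W x - x * p).
    have := h (fun x => ltac:(rewrite W1; ring)) t (- m); rewrite mulrNz; lra.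
  have WT w : W (iter i F (cret c k w)) = W (iter (i + cq c k) F w) - (cp c k)%:~R * p.
    by rewrite cret_iter /cret /ret Wz -iterD addnC.
  rewrite !WT (_ : _ - _ = dW (i + cq c k)%N); last by rewrite /dW; ring.
  rewrite ger0_norm// -iterD; apply: dW_le.
  by rewrite leq_add2r ltnW.
have s2 : \sum_(i < cq c k) `|W (iter i F (cret c k.+1 (cret c k y))) - W (iter i F (cret c k y))| <= 2 * e * E.
  rewrite -[leRHS]mulr1.
  have eE : 0 <= 2 * e * E by do 2![apply: mulr_ge0; last exact: ltW].
  apply: le_trans (ler_wpM2l eE (cdisp_sum y (cq_leS c k))).
  rewrite mulr_sumr; apply: ler_sum => i _.
  have ik : (i <= cq c k.+1 + cq c k)%N.
    by rewrite (leq_trans (ltnW (ltn_ord i)))// leq_addl.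
  apply: le_trans (dW_le i ik); rewrite -(ger0_norm (Fmono i)) /dW [leRHS]distrC.
  have hW : {homo (fun t => W (iter i F t)) : u v / u <= v}.
    by move=> u v uv; apply: Whomo; rewrite ler_iter.
  apply: between_dist; apply: (@between_homo _ (fun t => W (iter i F t))) => //.
    exact: (@between_tower _ _ c k 1 y (ca_gt0 c k)).
  exact: betweenr.
have : 2 * e * E + 2 * e * E = p / 2 by rewrite /e; field; rewrite gt_eqF.
lra.
Qed.

End Ergodicity.

(** * Uniform smallness of L at the return times *)

Section SmallDerivative.
Context {R : realType} (F : free_lift R) (c : convergents F) (M : R).
Hypothesis dlslope_le : forall x, `|dlslope F x| <= M.
Implicit Types (x y : R) (k n : nat).

Lemma lslope_lipschitz_degree : lipschitz_degree (lslope F).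
Proof.
split.
  by move=> t; rewrite lslopeD1 /deg -[X in lslope F X - _]add0r lslopeD1 subrr addr0.
exists M; first exact: le_trans (normr_ge0 _) (dlslope_le 0).
exact: lslope_lipschitz.
Qed.

(** Over a full period the [clip] of the periodic slope g is g up to a constant, so [incr] is
    exactly the difference of the two values of [lsum]. As M id + g and M id - g are nondecreasing,
    [disc_le_homo] with p = 0 bounds the limit from both sides; id contributes 0 over a period. *)
Lemma disc_lslope (xs ys : nat -> R) (G : set_system nat) {UG : UltraFilter G} :
  (\oo : set_system nat) `<=` G ->
  lsum F (cq c k.+1) (xs k) - lsum F (cq c k.+1) (ys k) @[k --> G] --> 0.
Proof.
move=> oo_le_G; have hg := lslope_lipschitz_degree.
have d0 : lslope F (0 + 1) - lslope F 0 = 0 by rewrite lslopeD1 subrr.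
have deg0 : deg (lslope F) = 0 by move: d0; rewrite add0r.
have U0 : disc c xs ys G (lslope F) 0 (0 + 1) = 0.
  have M0 : 0 <= M := le_trans (normr_ge0 _) (dlslope_le 0).
  have idd := @lipschitz_degree_id R.
  have u01 (t : R) : t <= t + 1 <= t + 1 by lra.
  have Uid_le (a b : R) : a <= b <= a + 1 -> disc c xs ys G id a b <= 0 * (b - a).
    by move=> ab; rewrite mul0r; apply: disc_id_le0 ab => //; exact: dlslope_le.
  have key s : `|s| <= 1 -> s * disc c xs ys G (lslope F) 0 (0 + 1) <= 0.
    move=> s1.
    have hder x : is_derive x 1 (fun x => s * lslope F x + M * id x) (s * dlslope F x + M).
      have d1 : is_derive x 1 (fun x => M * id x) M.
        by rewrite -[M in is_derive _ _ _ M]mulr1; apply: is_deriveZ.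
      have d2 : is_derive x 1 (fun x => s * lslope F x) (s * dlslope F x).
        by have := lslope_derive F x => ?; apply: is_deriveZ.
      exact: is_deriveD.
    have huc : uniformly_continuous (fun x => s * dlslope F x + M).
      move=> eps /(periodic_uniformly_continuous (@dlslope_continuous _ F) (dlslopeD1 F))[d e0 hd].
      exists d => // u v /hd h.
      rewrite (_ : _ - _ = s * (dlslope F u - dlslope F v)); last by ring.
      by rewrite normrM -[leRHS]mul1r ler_pM.
    have hpos x : 0 <= x <= 0 + 1 -> 0 <= s * dlslope F x + M.
      move=> _; have : `|s * dlslope F x| <= M by rewrite normrM -[leRHS]mul1r ler_pM.
      rewrite ler_norml => /andP[]; lra.
    have := disc_le_homo (lipschitz_degree_lin s M hg idd) hder huc (lexx 0) Uid_le (u01 0) hpos.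
    rewrite mul0r disc_lin// disc_id_unit mulr0 addr0; exact.
  have := key 1; have := key (-1); rewrite normrN1 normr1 lexx => /(_ isT) h1 /(_ isT) h2.
  lra.
have e t k : psum c k (lslope F) 0 (0 + 1) t = lsum F (cq c k.+1) t - \sum_(i < cq c k.+1) lslope F 0.
  rewrite -sumrB; apply: eq_bigr => i _; rewrite clip_unit; last by case: hg.
  by rewrite d0 deg0; ring.
have <- : incr c xs ys (lslope F) 0 (0 + 1) =
    (fun k => lsum F (cq c k.+1) (xs k) - lsum F (cq c k.+1) (ys k)).
  by apply/funext => k; rewrite /incr !e; ring.
by have := @disc_cvg _ _ c xs ys G UG (lslope F) 0 (0 + 1) hg; rewrite U0.
Qed.

Lemma lsum_cq_small (e : R) : 0 < e -> exists K, forall k x, (K <= k)%N ->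
  `|lsum F (cq c k) x| <= e.
Proof.
move=> e0; apply: contrapT => hN.
pose Bad k := exists x, e < `|lsum F (cq c k.+1) x|.
have frequent K : exists2 k, (K <= k)%N & Bad k.
  apply: contrapT => h; apply: hN; exists K.+1 => -[|k] x // Kk.
  rewrite leNgt; apply/negP => hx; apply: h; exists k => //; by exists x.
have /choice[xs hxs] k : exists x, Bad k -> e < `|lsum F (cq c k.+1) x|.
  by have [[x hx]|nb] := pselect (Bad k); [exists x|exists 0].
have /choice[ys hys] k : exists y, lsum F (cq c k.+1) y = 0 by exact: lsum_zero.
(* Restricting to the bad indices forces the ultrafilter to contain them. Elsewhere [xs] has the
   default value 0; [ys] is a zero of [lsum], so the difference is [lsum] at [xs]. *)
have PF : ProperFilter (within Bad \oo).
  split; last exact: within_filter.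
  by case=> K _ hK; have [k Kk bk] := frequent K; exact: hK k Kk bk.
have [G [UG hG]] := ultraFilterLemma PF.
have ooG : (\oo : set_system nat) `<=` G.
  by move=> A hA; apply: hG; apply: filterS hA => k Ak _.
have /cvgrPdist_lt/(_ e e0) h :
    lsum F (cq c k.+1) (xs k) - lsum F (cq c k.+1) (ys k) @[k --> G] --> 0.
  exact: disc_lslope.
have GB : G Bad by apply: hG; exists 0%N => // k _.
have [k []] := filter_ex (filterI h GB).
rewrite hys subr0 sub0r normrN => h1 /hxs h2.
by have := lt_trans h1 h2; rewrite ltxx.
Qed.

End SmallDerivative.

(** * Growth of the derivatives *)

Section SecondDerivative.
Context {R : realType} (F : free_lift R) (c : convergents F) (M : R).
Hypothesis dlslope_le : forall x, `|dlslope F x| <= M.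
Implicit Types (x y : R) (k n : nat).

Let M_ge0 : 0 <= M. Proof. exact: le_trans (normr_ge0 _) (dlslope_le 0). Qed.
Let E := expR M.
Let E_gt0 : 0 < E. Proof. exact: expR_gt0. Qed.

Lemma expR_dist (a b m : R) : a <= m -> b <= m -> `|expR a - expR b| <= expR m * `|a - b|.
Proof.
move=> am bm; have [z hz ->] := MVT_between b a (@is_derive_expR R).
rewrite normrM ger0_norm ?expR_ge0// ler_wpM2r// ler_expR.
by case/orP: hz; lra.
Qed.

(** In the sum defining [dlsum] the first factor varies by [om], since the images of x and y stay
    within d, and the second by bounded distortion. Summing the derivatives then costs E / |T_k x -
    x|. *)
Lemma dlsum_slow k x y (eta om d : R) :
  between x (cret c k x) y -> `|y - x| <= eta * cdisp c k x -> 0 <= eta ->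
  E ^+ 2 * eta <= d -> 0 <= om ->
  (forall u v, `|u - v| <= d -> `|dlslope F u - dlslope F v| <= om) ->
  `|dlsum F (cq c k.+1) y - dlsum F (cq c k.+1) x| <=
  (om + M * (M * (E ^+ 2 * eta))) * E ^+ 2 / cdisp c k x.
Proof.
move=> hy yx eta0 etad om0 hom; have cd0 := cdisp_gt0 c k x.
have bx := betweenl x (cret c k x).
have near i : (i <= cq c k.+1)%N -> expR (lsum F i y) <= E * expR (lsum F i x).
  move=> iq; rewrite -expRD ler_expR.
  by have := lsum_tile_dist dlslope_le iq hy bx; rewrite ler_norml => /andP[]; lra.
have dist i : (i <= cq c k.+1)%N ->
    `|iter i F y - iter i F x| <= E * eta * cdisp c k x * expR (lsum F i x).
  move=> iq; have [z hz ->] := MVT_between x y (iter_derive F i).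
  have bz := between_shrink bx hy hz.
  rewrite normrM (ger0_norm (expR_ge0 _)).
  have h : expR (lsum F i z) <= E * expR (lsum F i x).
    rewrite -expRD ler_expR.
    by have := lsum_tile_dist dlslope_le iq bz bx; rewrite ler_norml => /andP[]; lra.
  apply: le_trans (ler_pM (expR_ge0 _) (normr_ge0 _) h yx) _.
  by rewrite le_eqVlt; apply/orP; left; apply/eqP; ring.
have sig n : (n <= cq c k.+1)%N -> cdisp c k x * \sum_(i < n) expR (lsum F i x) <= E.
  move=> nq; rewrite mulrC -ler_pdivlMr//; exact: expR_lsum_sum.
have Eeta s : cdisp c k x * s <= E -> E * eta * cdisp c k x * s <= E ^+ 2 * eta.
  move=> h; have := ler_wpM2l (mulr_ge0 (ltW E_gt0) eta0) h; rewrite expr2; lra.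
have dist1 i : (i < cq c k.+1)%N -> `|iter i F y - iter i F x| <= d.
  move=> iq; apply: le_trans (dist i (ltnW iq)) _; apply: le_trans etad.
  have := sig i.+1 iq; rewrite big_ord_recr /= => h.
  have h0 : 0 <= cdisp c k x * \sum_(i0 < i) expR (lsum F i0 x).
    by apply: mulr_ge0; [exact: ltW|apply: sumr_ge0 => j _; exact: expR_ge0].
  apply: Eeta; rewrite mulrDr in h; lra.
have lsd i : (i <= cq c k.+1)%N -> `|lsum F i y - lsum F i x| <= M * (E ^+ 2 * eta).
  move=> iq; apply: le_trans (lsum_dist dlslope_le _ _ _) _; apply: ler_wpM2l => //.
  apply: (@le_trans _ _ (\sum_(j < i) E * eta * cdisp c k x * expR (lsum F j x))).
    by apply: ler_sum => j _; apply: dist; rewrite (leq_trans (ltnW (ltn_ord j))).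
  by rewrite -mulr_sumr; apply: Eeta; exact: sig.
rewrite -sumrB; apply: le_trans (ler_norm_sum _ _ _) _.
apply: (@le_trans _ _ (\sum_(i < cq c k.+1) (om + M * (M * (E ^+ 2 * eta))) * E * expR (lsum F i x))).
  apply: ler_sum => i _; have iq := ltnW (ltn_ord i).
  rewrite (_ : _ - _ = (dlslope F (iter i F y) - dlslope F (iter i F x)) * expR (lsum F i y) +
     dlslope F (iter i F x) * (expR (lsum F i y) - expR (lsum F i x))); last by ring.
  apply: le_trans (ler_normD _ _) _.
  rewrite [leRHS](_ : _ = om * (E * expR (lsum F i x)) +
    M * (E * expR (lsum F i x) * (M * (E ^+ 2 * eta)))); last by ring.
  apply: lerD.
    rewrite normrM (ger0_norm (expR_ge0 _)); apply: ler_pM => //; last exact: near.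
    exact: hom (dist1 i (ltn_ord i)).
  rewrite normrM; apply: ler_pM => //.
  apply: le_trans (@expR_dist _ _ (M + lsum F i x) _ _) _.
  - by have := near i iq; rewrite -expRD ler_expR.
  - by rewrite lerDr.
  - by rewrite expRD ler_wpM2l ?mulr_ge0 ?expR_ge0// lsd.
rewrite -mulr_sumr [leRHS](_ : _ = (om + M * (M * (E ^+ 2 * eta))) * E * (E / cdisp c k x)); last by ring.
apply: ler_wpM2l.
  apply: mulr_ge0; last exact: ltW.
  by apply: addr_ge0 => //; do 3![apply: mulr_ge0 => //]; exact: sqr_ge0.
exact: expR_lsum_sum.
Qed.

(** A small function with slowly varying derivative has a small derivative: between x and a point y
    at distance eta |T_k x - x| the mean value theorem finds a z where [dlsum] is small, and
    [dlsum_slow] carries the bound from z to x. *)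
Lemma dlsum_small (e : R) : 0 < e -> exists K, forall k x, (K <= k)%N ->
  `|dlsum F (cq c k.+1) x| <= e / cdisp c k x.
Proof.
move=> e0.
have E20 : 0 < E ^+ 2 by rewrite exprn_gt0.
pose om : R := e / (4 * E ^+ 2); have om0 : 0 < om by rewrite divr_gt0// mulr_gt0.
have [d d0 hd] := periodic_uniformly_continuous (@dlslope_continuous _ F) (dlslopeD1 F) om0.
(* eta = 1 / B must be at most 1 to keep y in the tile, keep the images within d, and make the
   second-order error at most e / 4. B is the sum of the three lower bounds. *)
pose B := 1 + M ^+ 2 * E ^+ 2 * E ^+ 2 * 4 / e + E ^+ 2 / d.
have B1 : 0 <= M ^+ 2 * E ^+ 2 * E ^+ 2 * 4 / e.
  by rewrite divr_ge0 ?mulr_ge0 ?sqr_ge0// ltW.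
have B2 : 0 <= E ^+ 2 / d by rewrite divr_ge0 ?sqr_ge0// ltW.
have BY : M ^+ 2 * E ^+ 2 * E ^+ 2 * 4 / e <= B by rewrite /B addrAC lerDr addr_ge0.
have BX : E ^+ 2 / d <= B by rewrite /B lerDr addr_ge0.
have BB : 1 <= B by rewrite /B -addrA lerDl addr_ge0.
have B0 : 0 < B := lt_le_trans ltr01 BB.
pose eta := B^-1; have eta0 : 0 < eta by rewrite invr_gt0.
have etaB : eta * B = 1 by rewrite mulVf ?gt_eqF.
have eta1 : eta <= 1 by rewrite invf_le1.
have etad : E ^+ 2 * eta <= d.
  have : E ^+ 2 / d * eta <= 1.
    by rewrite -[leRHS]etaB mulrC; apply: ler_wpM2l => //; rewrite ltW.
  by rewrite mulrAC ler_pdivrMr// mul1r.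
have etae : M * (M * (E ^+ 2 * eta)) * E ^+ 2 <= e / 4.
  have : M ^+ 2 * E ^+ 2 * E ^+ 2 * 4 / e * eta <= 1.
    by rewrite -[leRHS]etaB mulrC; apply: ler_wpM2l => //; rewrite ltW.
  rewrite mulrAC ler_pdivrMr// mul1r; lra.
have e1 : 0 < e * eta / 4 by rewrite divr_gt0// mulr_gt0.
have [K hK] := lsum_cq_small c dlslope_le e1.
exists K => k x Kk; have cd0 := cdisp_gt0 c k x.
pose y := x + eta * (cret c k x - x).
have hy : between x (cret c k x) y.
  rewrite /between /y; case: (leP x (cret c k x)) => h.
    have h1 : 0 <= eta * (cret c k x - x) by apply: mulr_ge0; [exact: ltW|lra].
    have h2 : 0 <= (1 - eta) * (cret c k x - x) by apply: mulr_ge0; lra.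
    by apply/orP; left; lra.
  have h1 : 0 <= eta * (x - cret c k x) by apply: mulr_ge0; [exact: ltW|lra].
  have h2 : 0 <= (1 - eta) * (x - cret c k x) by apply: mulr_ge0; lra.
  by apply/orP; right; lra.
have yx : `|y - x| = eta * cdisp c k x.
  by rewrite /y addrAC subrr add0r normrM (ger0_norm (ltW eta0)).
have [z hz ez] := MVT_between x y (lsum_derive F (cq c k.+1)).
have bx := betweenl x (cret c k x).
have bz := between_shrink bx hy hz.
have zx : `|z - x| <= eta * cdisp c k x.
  by rewrite -yx (distrC y x); apply: between_dist => //; exact: betweenl.
have h1 := dlsum_slow bz zx (ltW eta0) etad (ltW om0) hd.
have h2 : `|dlsum F (cq c k.+1) z| <= e / 2 / cdisp c k x.
  have : `|lsum F (cq c k.+1) y - lsum F (cq c k.+1) x| <= e * eta / 2.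
    apply: le_trans (ler_normB _ _) _.
    have := hK k.+1 y (leqW Kk); have := hK k.+1 x (leqW Kk); lra.
  rewrite ez normrM yx => h; rewrite ler_pdivlMr// -(ler_pM2r eta0); lra.
have h3 : (om + M * (M * (E ^+ 2 * eta))) * E ^+ 2 / cdisp c k x <= e / 2 / cdisp c k x.
  apply: ler_wpM2r; first by rewrite invr_ge0 ltW.
  rewrite mulrDl (_ : om * E ^+ 2 = e / 4); first lra.
  by rewrite /om; field; rewrite gt_eqF.
have := ler_normB (dlsum F (cq c k.+1) z) (dlsum F (cq c k.+1) z - dlsum F (cq c k.+1) x).
rewrite subKr => h; apply: (le_trans h).
rewrite (_ : e / cdisp c k x = e / 2 / cdisp c k x + e / 2 / cdisp c k x); last by field; rewrite gt_eqF.
by apply: lerD => //; exact: le_trans h1 h3.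
Qed.

End SecondDerivative.

Lemma expR_half_le2 (R : realType) : expR (2^-1 : R) <= 2.
Proof.
have h := expR_ge1Dx (- 2^-1 : R); rewrite expRN in h.
have h0 := expR_gt0 (2^-1 : R).
have : (1 + - 2^-1) * expR (2^-1 : R) <= 1 by rewrite -ler_pdivlMr// div1r.
lra.
Qed.

Lemma expR_near1 (R : realType) (u : R) : `|u| <= (2^-1 : R) -> `|expR u - 1| <= 2 * `|u|.
Proof.
rewrite ler_norml => /andP[u1 u2]; rewrite -[X in _ - X]expR0.
have := @expR_dist _ u 0 2^-1 u2; rewrite subr0 invr_ge0 ler0n => /(_ isT) h.
by apply: le_trans h _; rewrite ler_wpM2r// expR_half_le2.
Qed.

(* One step of the recurrence [D' - D = O(D^(3/2))] moves [1/sqrt D] by [O(1)]. *)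
Lemma invsqrt_step (R : realType) (th w a b : R) : 0 < th -> 0 < w -> 0 < a -> 0 < b ->
  (b ^+ 2 - a ^+ 2) ^+ 2 <= 32 * (th ^+ 2 / w ^+ 2) * (a ^+ 2) ^+ 3 ->
  a ^+ 2 / 2 <= b ^+ 2 -> `|b^-1 - a^-1| <= 9 * th / w.
Proof.
move=> th0 w0 a0 b0 h1 h2.
(* From a^2 <= 2 b^2 and 2 <= 9/4. The final 9 is 6 * 3/2, where 6 comes from 32 <= 36. *)
have ab : a <= 3 / 2 * b.
  rewrite -(@ler_pXn2r _ 2) ?nnegrE ?(ltW a0)//; last lra.
  by rewrite (_ : (3 / 2 * b) ^+ 2 = 9 / 4 * b ^+ 2); [have := sqr_ge0 b; lra|field].
have x0 : 0 <= 6 * th * a ^+ 3 / w by rewrite divr_ge0 ?mulr_ge0 ?exprn_ge0 ?(ltW a0) ?(ltW b0) ?(ltW th0) ?(ltW w0).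
have h3 : `|b ^+ 2 - a ^+ 2| <= 6 * th * a ^+ 3 / w.
  rewrite -(@ler_pXn2r _ 2) ?nnegrE// real_normK ?num_real//.
  apply: (le_trans h1).
  rewrite (_ : (6 * th * a ^+ 3 / w) ^+ 2 = 36 * (th ^+ 2 / w ^+ 2) * (a ^+ 2) ^+ 3); last first.
    by field; rewrite gt_eqF.
  apply: ler_wpM2r; first by rewrite exprn_ge0// sqr_ge0.
  by apply: ler_wpM2r; [rewrite divr_ge0 ?sqr_ge0|lra].
have h4 : `|b - a| * a <= 6 * th * a ^+ 3 / w.
  apply: le_trans h3; rewrite (_ : b ^+ 2 - a ^+ 2 = (b - a) * (b + a)); last by ring.
  rewrite normrM (@ger0_norm _ (b + a)) ?addr_ge0 ?(ltW a0) ?(ltW b0)//.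
  by apply: ler_wpM2l => //; lra.
rewrite (_ : b^-1 - a^-1 = - (b - a) / (a * b)); last first.
  by field; rewrite !gt_eqF.
rewrite normrM normrN normfV (@ger0_norm _ (a * b)) ?mulr_ge0 ?(ltW a0) ?(ltW b0) ?(ltW th0) ?(ltW w0)//.
rewrite ler_pdivrMr ?mulr_gt0// -(ler_pM2r a0); apply: le_trans h4 _.
rewrite (_ : 9 * th / w * (a * b) * a = 6 * th * a ^+ 2 / w * (3 / 2 * b)); last by field; rewrite gt_eqF.
rewrite (_ : 6 * th * a ^+ 3 / w = 6 * th * a ^+ 2 / w * a); last by field; rewrite gt_eqF.
by rewrite ler_wpM2l// divr_ge0 ?mulr_ge0 ?exprn_ge0 ?(ltW a0) ?(ltW b0) ?(ltW th0) ?(ltW w0).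
Qed.

(** * Growth along the steps of one level *)

Section Tower.
Context {R : realType} (F : free_lift R) (c : convergents F) (k : nat) (th e : R).
Hypothesis th_gt0 : 0 < th.
Hypothesis th_le : th <= 4^-1.
Hypothesis eE : e = th ^+ 2.
Hypothesis lsum_k : forall x, `|lsum F (cq c k) x| <= e.
Hypothesis lsum_k1 : forall x, `|lsum F (cq c k.+1) x| <= e.
Hypothesis dlsum_k1 : forall x, `|dlsum F (cq c k.+1) x| <= e / cdisp c k x.
Implicit Types (x y z : R) (i j b : nat).

Let e_gt0 : 0 < e. Proof. by rewrite eE exprn_gt0. Qed.
Let e_le : e <= 16^-1.
Proof. by have := th_le; have := @ler_pM R th 4^-1 th 4^-1 (ltW th_gt0) (ltW th_gt0) th_le th_le; rewrite -expr2 -eE; lra. Qed.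

Let small x : `|x| <= e -> `|expR x - 1| <= 2 * e.
Proof.
move=> xe; apply: le_trans (expR_near1 _) _; last by rewrite ler_pM2l.
by apply: le_trans xe _; have := e_le; lra.
Qed.

Section Fundamental.
Context (z : R).
Context (c0 : R).
Hypothesis c0E : c0 = cdisp c k z.
Let c0_gt0 : 0 < c0. Proof. by rewrite c0E cdisp_gt0. Qed.

(** T_k has slope within 2 e of 1, so its displacement hardly varies. The radius 3/2 c0 covers the
    tile, of length c0, and the excursion of at most c0 / 4 in [parabolic]. *)
Let cdisp_lower y : `|y - z| <= 3 / 2 * c0 -> c0 / 2 <= cdisp c k y.
Proof.
have [[e0 e16] c00] := (e_gt0, e_le, c0_gt0).
move=> yz; have [xi _ exi] := MVT_between z y (fun x => ret_derive F (cq c k) (cp c k) x).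
have h1 : `|(expR (lsum F (cq c k) xi) - 1) * (y - z)| <= 2 * e * (3 / 2 * c0).
  by rewrite normrM; apply: ler_pM => //; exact: small.
have h2 : e * c0 <= 16^-1 * c0 by rewrite ler_pM2r.
have := ler_distD (cret c k y - y) (cret c k z - z) 0; rewrite !subr0 -/(cdisp c k y) -/(cdisp c k z) -c0E.
rewrite (_ : cret c k z - z - (cret c k y - y) = - ((expR (lsum F (cq c k) xi) - 1) * (y - z))).
  by rewrite normrN; lra.
by rewrite /cret mulrBl -exi; ring.
Qed.

Let lsum_lip x y : `|x - z| <= 3 / 2 * c0 -> `|y - z| <= 3 / 2 * c0 ->
  `|lsum F (cq c k.+1) x - lsum F (cq c k.+1) y| <= 2 * e / c0 * `|x - y|.
Proof.
have [[e0 e16] c00] := (e_gt0, e_le, c0_gt0).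
move=> xz yz; have [xi hxi ->] := MVT_between y x (lsum_derive F (cq c k.+1)).
have hz : `|xi - z| <= 3 / 2 * c0.
  by move: xz yz; rewrite !ler_norml; case/orP: hxi => /andP[h1 h2] /andP[h3 h4] /andP[h5 h6]; apply/andP; split; lra.
rewrite normrM ler_wpM2r//; apply: le_trans (dlsum_k1 _) _.
rewrite ler_pdivrMr ?cdisp_gt0//.
have h := cdisp_lower hz.
have : 2 * e / c0 * (c0 / 2) <= 2 * e / c0 * cdisp c k xi.
  by rewrite ler_wpM2l// divr_ge0 ?mulr_ge0 ?ltW.
by rewrite (_ : 2 * e / c0 * (c0 / 2) = e)//; field; rewrite gt_eqF.
Qed.

Let signE y : cdisp c k.+1 y = (-1) ^+ k * (cret c k.+1 y - y).
Proof.
rewrite /cdisp -(normrMsign k) ger0_norm//.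
have := ret_side c k.+1 y; rewrite -/(cret c k.+1 y) exprS; lra.
Qed.

Let between_c0 y : between z (cret c k z) y -> `|y - z| <= c0.
Proof.
by move=> hy; rewrite c0E /cdisp (distrC (cret c k z)); apply: between_dist => //; exact: betweenl.
Qed.

(* [cdisp c k.+1] is a positive function with small second derivative, so its
   first derivative is of the order of its square root. *)
Let parabolic y : between z (cret c k z) y ->
  (expR (lsum F (cq c k.+1) y) - 1) ^+ 2 <= 16 * e * cdisp c k.+1 y / c0.
Proof.
have [[e0 e16] c00] := (e_gt0, e_le, c0_gt0).
move=> /between_c0 yz; set A := expR _ - 1.
have A2 : `|A| <= 2 * e by exact: small.
pose sA : R := if 0 <= (-1) ^+ k * A then 1 else -1.
have sAE : sA * ((-1) ^+ k * A) = `|A|.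
  rewrite -(normrMsign k) /sA; case: ifPn => h; first by rewrite mul1r ger0_norm.
  by rewrite ler0_norm ?mulN1r// ltW// ltNge.
have sA1 : `|sA| = 1 by rewrite /sA; case: ifP; rewrite ?normrN normr1.
(* Moving by r in the direction in which the displacement decreases lowers it by |A| r, up to a
   second-order error 4 e r^2 / c0, which this r makes equal to |A| r / 2. The displacement stays
   positive, so it was at least |A| r / 2. *)
pose r := `|A| * c0 / (8 * e).
have r0 : 0 <= r by apply: divr_ge0; apply: mulr_ge0 => //; exact: ltW.
have r1 : r <= c0 / 4.
  rewrite ler_pdivrMr ?mulr_gt0//; have := ler_wpM2r (ltW c0_gt0) A2; lra.
pose y' := y - sA * r.
have yy' : `|y' - y| = r by rewrite /y' addrAC subrr add0r normrN normrM sA1 mul1r ger0_norm.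
have [xi hxi exi] := MVT_between y y' (fun x => ret_derive F (cq c k.+1) (cp c k.+1) x).
have xiy : `|xi - y| <= r.
  by rewrite -yy' (distrC y'); apply: between_dist hxi _; exact: betweenl.
have hz : `|xi - z| <= 3 / 2 * c0.
  by apply: le_trans (ler_distD y _ _) _; lra.
have yz2 : `|y - z| <= 3 / 2 * c0 by lra.
have dexp : `|expR (lsum F (cq c k.+1) xi) - expR (lsum F (cq c k.+1) y)| <= 4 * e / c0 * r.
  apply: le_trans (@expR_dist _ _ _ 2^-1 _ _) _.
  - by have := lsum_k1 xi; rewrite ler_norml => /andP[]; lra.
  - by have := lsum_k1 y; rewrite ler_norml => /andP[]; lra.
  rewrite (_ : 4 * e / c0 * r = 2 * (2 * e / c0 * r)); last by ring.
  apply: ler_pM => //; first exact: expR_half_le2.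
  apply: le_trans (lsum_lip hz yz2) _; rewrite ler_wpM2l//.
  by rewrite divr_ge0 ?mulr_ge0 ?ltW.
have pos := cdisp_gt0 c k.+1 y'.
have e1 : cdisp c k.+1 y' = cdisp c k.+1 y - `|A| * r -
   (-1) ^+ k * (expR (lsum F (cq c k.+1) xi) - expR (lsum F (cq c k.+1) y)) * (sA * r).
  rewrite !signE -sAE /A; have -> : cret c k.+1 y' = cret c k.+1 y + expR (lsum F (cq c k.+1) xi) * (y' - y).
    by rewrite /cret -exi; ring.
  by rewrite /y'; ring.
have e2 : `|(-1) ^+ k * (expR (lsum F (cq c k.+1) xi) - expR (lsum F (cq c k.+1) y)) * (sA * r)| <= 4 * e / c0 * r * r.
  by rewrite -mulrA normrMsign normrM normrM sA1 mul1r (ger0_norm r0) ler_wpM2r.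
have e3 : 4 * e / c0 * r * r = `|A| * r / 2.
  by rewrite /r; field; rewrite !gt_eqF.
have : `|A| * r / 2 <= cdisp c k.+1 y.
  by move: e2; rewrite e3 ler_norml => /andP[h1 h2]; rewrite e1 in pos; lra.
rewrite /r -(@real_normK _ A) ?num_real// => h.
rewrite ler_pdivlMr//.
have : `|A| * (`|A| * c0 / (8 * e)) / 2 * (16 * e) <= cdisp c k.+1 y * (16 * e).
  by rewrite ler_pM2r ?mulr_gt0.
rewrite (_ : `|A| * (`|A| * c0 / (8 * e)) / 2 * (16 * e) = `|A| ^+ 2 * c0); first lra.
by field; rewrite gt_eqF.
Qed.

(** The tower starts at T_k z, so that by [between_tower] its first [ca c k] steps stay between z
    and T_k z. *)
Let x_ j := iter j (cret c k.+1) (cret c k z).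
Let D j : R := cdisp c k.+1 (x_ j).

Let D_gt0 j : 0 < D j. Proof. exact: cdisp_gt0. Qed.

Let x_between j : (j <= ca c k)%N -> between z (cret c k z) (x_ j).
Proof. exact: between_tower. Qed.

(** The increment is D j times the derivative of the displacement at an intermediate point, to which
    [parabolic] applies; the displacement there is at most 2 D j, whence 32 = 16 * 2. *)
Let D_step j : (j < ca c k)%N ->
  (D j.+1 - D j) ^+ 2 <= 32 * (e / c0) * D j ^+ 3 /\ D j / 2 <= D j.+1 <= 2 * D j.
Proof.
have [[e0 e16] c00] := (e_gt0, e_le, c0_gt0).
move=> jk; have b0 := x_between (ltnW jk); have b1 := x_between jk.
have D0 := D_gt0 j.
have disp y : between (x_ j) (x_ j.+1) y -> exists xi, [/\ between (x_ j) (x_ j.+1) xi,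
    cdisp c k.+1 y - D j = (-1) ^+ k * ((expR (lsum F (cq c k.+1) xi) - 1) * (y - x_ j)) &
    `|y - x_ j| <= D j].
  move=> hy; have [xi hxi exi] := MVT_between (x_ j) y (fun x => ret_derive F (cq c k.+1) (cp c k.+1) x).
  exists xi; split; first exact: between_shrink (betweenl _ _) hy hxi.
    rewrite /D !signE; have -> : cret c k.+1 y = cret c k.+1 (x_ j) + expR (lsum F (cq c k.+1) xi) * (y - x_ j).
      by rewrite /cret -exi; ring.
    by ring.
  rewrite /D /cdisp -[cret c k.+1 (x_ j)]/(x_ j.+1) (distrC (x_ j.+1)).
  by apply: between_dist => //; exact: betweenl.
have rough y : between (x_ j) (x_ j.+1) y -> `|cdisp c k.+1 y - D j| <= 8^-1 * D j.
  move=> /disp[xi [_ -> h]]; rewrite normrMsign normrM; apply: ler_pM => //.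
  by apply: le_trans (small (lsum_k1 _)) _; lra.
have [xi [hxi exi _]] := disp _ (betweenr (x_ j) (x_ j.+1)).
have r1 := rough _ (betweenr _ _); have r2 := rough _ hxi.
have xb := between_shrink b0 b1 hxi.
have := parabolic xb.
split; last by move: r1; rewrite -/(D j.+1) ler_norml => /andP[h1 h2]; apply/andP; split; lra.
rewrite /D -/(D j) exi exprMn sqrr_sign mul1r exprMn.
rewrite (_ : 32 * (e / c0) * D j ^+ 3 = 16 * e * (2 * D j) / c0 * D j ^+ 2); last by field; rewrite gt_eqF.
apply: ler_pM; rewrite ?sqr_ge0//.
  apply: (le_trans (parabolic xb)); rewrite ler_wpM2r ?invr_ge0 ?(ltW c00)//.
  rewrite ler_wpM2l ?mulr_ge0 ?(ltW e0)//.
  by move: r2; rewrite ler_norml => /andP[h1 h2]; lra.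
by rewrite -[leLHS]real_normK ?num_real.
Qed.

Let D_le j : (j <= ca c k)%N -> D j <= 2 * c0.
Proof.
have [[e0 e16] c00] := (e_gt0, e_le, c0_gt0).
have lt i : (i < ca c k)%N -> D i <= c0.
  move=> ik; rewrite /D /cdisp -[cret c k.+1 (x_ i)]/(x_ i.+1) c0E /cdisp (distrC (cret c k z)).
  exact: between_dist (x_between ik) (x_between (ltnW ik)).
case: j => [|j] jk; first by have := lt 0%N (ca_gt0 c k); lra.
by have [_ /andP[_]] := D_step jk; have := lt j jk; lra.
Qed.

(** Summation of [invsqrt_step]. Since [parabolic] bounds the square of a derivative by a multiple
    of e, the rate is th with e = th^2. *)
Let invsqrt_D j : (j <= ca c k)%N ->
  `|(Num.sqrt (D j))^-1 - (Num.sqrt (D 0))^-1| <= j%:R * (9 * th / Num.sqrt c0).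
Proof.
elim: j => [|j ih] jk; first by rewrite subrr normr0 mul0r.
have [h1 /andP[h2 _]] := D_step jk.
rewrite -natr1 mulrDl mul1r [leRHS]addrC.
apply: le_trans (ler_distD (Num.sqrt (D j))^-1 _ _) _; apply: lerD; last exact: ih (ltnW jk).
apply: invsqrt_step; rewrite ?sqrtr_gt0 ?D_gt0 ?c0_gt0 ?th_gt0//.
  by rewrite !sqr_sqrtr ?(ltW (D_gt0 _)) ?(ltW c0_gt0)// -eE.
by rewrite !sqr_sqrtr ?(ltW (D_gt0 _)).
Qed.

Let ratio_D j : (0 < j <= ca c k)%N ->
  Num.sqrt (D j) / Num.sqrt (D 0) <= 1 + 14 * j%:R * th /\
  Num.sqrt (D 0) / Num.sqrt (D j) <= 1 + 14 * j%:R * th.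
Proof.
move=> /andP[j0 jk]; have [th0 c00] := (th_gt0, c0_gt0).
have sD i : 0 < Num.sqrt (D i) by rewrite sqrtr_gt0.
have sc : 0 < Num.sqrt c0 by rewrite sqrtr_gt0.
(* 3/2 exceeds sqrt 2, which covers D <= 2 c0 from [D_le]; then 9 * 3/2 = 27/2 is rounded up to
   14. *)
have key (a b : R) : 0 < a -> 0 < b -> `|a^-1 - b^-1| <= j%:R * (9 * th / Num.sqrt c0) ->
    b <= 3 / 2 * Num.sqrt c0 -> b / a <= 1 + 14 * j%:R * th.
  move=> a0 b0 h hb.
  have : b * (a^-1 - b^-1) <= b * (j%:R * (9 * th / Num.sqrt c0)).
    by apply: ler_wpM2l; [exact: ltW|exact: le_trans (ler_norm _) h].
  rewrite mulrBr divff ?gt_eqF// => h1.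
  have h2 : b * (j%:R * (9 * th / Num.sqrt c0)) <= 27 / 2 * j%:R * th.
    rewrite (_ : b * _ = 9 * j%:R * th * b / Num.sqrt c0); last by field; rewrite gt_eqF.
    rewrite ler_pdivrMr//.
    have := ler_wpM2l (_ : 0 <= 9 * j%:R * th) hb.
    rewrite !mulr_ge0 ?ler0n ?(ltW th0)// => /(_ isT); lra.
  have : 0 <= j%:R * th by rewrite mulr_ge0 ?ler0n ?(ltW th0).
  lra.
have sle (a : R) : 0 <= a -> a <= 2 * c0 -> Num.sqrt a <= 3 / 2 * Num.sqrt c0.
  move=> a0 ha; have q0 : 0 <= 3 / 2 * Num.sqrt c0 by lra.
  rewrite -(@ler_pXn2r _ 2) ?nnegrE ?q0 ?sqrtr_ge0//.
  rewrite (_ : (3 / 2 * Num.sqrt c0) ^+ 2 = 9 / 4 * (Num.sqrt c0) ^+ 2); last by field.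
  rewrite !sqr_sqrtr ?(ltW c00)//; lra.
have h := invsqrt_D jk; split; apply: key => //.
- by rewrite distrC.
- by apply: sle; [exact: ltW|exact: D_le].
- by apply: sle; [exact: ltW|exact: D_le].
Qed.

Let iter_retE n x : iter n (cret c k.+1) x = iter (n * cq c k.+1) F x - (n%:Z * cp c k.+1)%:~R.
Proof. by rewrite iter_cret. Qed.

(** The images of the first step are the successive, adjacent steps of the tower, so their lengths
    telescope. All of them lie in one tile, hence the distortion is at most 2 e for every n. *)
Let lsum_tower n xi : (n <= ca c k)%N -> between (x_ 0) (x_ 1) xi ->
  `|lsum F (n * cq c k.+1) (x_ 0) - lsum F (n * cq c k.+1) xi| <=
  2 * e / c0 * ((-1) ^+ k * (x_ n - x_ 0)).
Proof.
move=> + hxi; have [[e0 e16] c00] := (e_gt0, e_le, c0_gt0).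
elim: n => [|n ih] nk; first by rewrite mul0n !lsum0 !subrr normr0 !mulr0.
have {}ih := ih (ltnW nk).
rewrite mulSn addnC !lsumD.
have perE x : lsum F (cq c k.+1) (iter (n * cq c k.+1) F x) = lsum F (cq c k.+1) (iter n (cret c k.+1) x).
  by rewrite iter_retE -mulrNz lsumDz.
rewrite !perE -[iter n _ (x_ 0)]/(x_ n); set xn := iter n _ xi.
have bn : between (x_ n) (x_ n.+1) xn.
  have -> : x_ n.+1 = iter n (cret c k.+1) (x_ 1) by rewrite /x_ iterSr.
  rewrite -[x_ n]/(iter n (cret c k.+1) (x_ 0)) /xn.
  apply: (@between_homo _ (iter n (cret c k.+1))) hxi => s t st.
  by rewrite !iter_retE lerD2r ler_iter.
have b0 := x_between (ltnW nk); have b1 := x_between nk.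
have bz := between_shrink b0 b1 bn.
have h1 : `|x_ n - z| <= 3 / 2 * c0 by have := between_c0 b0; lra.
have h2 : `|xn - z| <= 3 / 2 * c0 by have := between_c0 bz; lra.
have h3 := lsum_lip h1 h2.
have h4 : `|x_ n - xn| <= (-1) ^+ k * (x_ n.+1 - x_ n).
  rewrite -[X in _ <= (-1) ^+ k * (X - _)]/(cret c k.+1 (x_ n)) -signE /cdisp (distrC (cret _ _ _)).
  by rewrite -[cret c k.+1 (x_ n)]/(x_ n.+1); apply: between_dist => //; exact: betweenl.
have ec : 0 <= 2 * e / c0 by rewrite divr_ge0 ?mulr_ge0 ?ltW.
have := le_trans h3 (ler_wpM2l ec h4).
rewrite (_ : lsum F (n * cq c k.+1) (x_ 0) + lsum F (cq c k.+1) (x_ n) -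
  (lsum F (n * cq c k.+1) xi + lsum F (cq c k.+1) xn) =
  (lsum F (n * cq c k.+1) (x_ 0) - lsum F (n * cq c k.+1) xi) +
  (lsum F (cq c k.+1) (x_ n) - lsum F (cq c k.+1) xn)); last by ring.
move=> h5; apply: le_trans (ler_normD _ _) _; apply: le_trans (lerD ih h5) _.
by rewrite le_eqVlt; apply/orP; left; apply/eqP; ring.
Qed.

(** D n / D 0 is the slope of F^(n q_(k+1)) at some xi in the first step, so the square root of this
    ratio, or of its inverse, is the wanted exponential at xi. [lsum_tower] replaces xi by x at the
    cost of a factor exp e. *)
Lemma tower_growth_base b : (b <= ca c k)%N ->
  expR (`|lsum F (b * cq c k.+1) (cret c k z)| / 2) <= 1 + 23 * th * b%:R.
Proof.
have [[e0 e16] c00] := (e_gt0, e_le, c0_gt0); have [th0 th4] := (th_gt0, th_le).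
case: b => [_|b bk]; first by rewrite mul0n lsum0 normr0 mul0r expR0 mulr0 addr0.
set n := b.+1; set x := cret c k z.
have [xi hxi exi] := cdisp_iter c (n * cq c k.+1) k.+1 x.
have eD : expR (lsum F (n * cq c k.+1) xi) = D n / D 0.
  rewrite /D -[x_ 0]/x (_ : cdisp c k.+1 (x_ n) = cdisp c k.+1 (iter (n * cq c k.+1) F x)).
    by rewrite exi mulfK// gt_eqF// cdisp_gt0.
  rewrite /x_ iter_retE -/x /cdisp /cret /ret -mulrNz iterDz; congr `|_|; ring.
set v := lsum F (n * cq c k.+1) xi.
have sE : expR (v / 2) = Num.sqrt (D n) / Num.sqrt (D 0).
  apply/eqP; rewrite -(@eqrXn2 _ 2) ?expR_ge0// ?divr_ge0 ?sqrtr_ge0//.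
  rewrite -expRM_natl expr_div_n !sqr_sqrtr ?(ltW (D_gt0 _))// -eD.
  by apply/eqP; congr expR; rewrite -/v; field.
have sN : expR (- v / 2) = Num.sqrt (D 0) / Num.sqrt (D n).
  by rewrite mulNr expRN sE invf_div.
have [r1 r2] : Num.sqrt (D n) / Num.sqrt (D 0) <= 1 + 14 * n%:R * th /\
  Num.sqrt (D 0) / Num.sqrt (D n) <= 1 + 14 * n%:R * th by exact: ratio_D.
have h := lsum_tower bk hxi; rewrite -/n -[x_ 0]/x in h.
have h2 : `|lsum F (n * cq c k.+1) x - v| <= 2 * e.
  apply: (le_trans h); rewrite mulrAC ler_pdivrMr//.
  rewrite ler_wpM2l ?mulr_ge0 ?(ltW e0)//.
  apply: le_trans (ler_norm _) _; rewrite normrMsign c0E /cdisp (distrC (cret c k z)).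
  by apply: between_dist (x_between bk) _; exact: betweenr.
have e1 : expR e <= 1 + 2 * e.
  have ee : `|e| <= e by rewrite ger0_norm// ltW.
  by have := small ee; rewrite ler_norml => /andP[]; lra.
have e2 : e <= th by rewrite eE expr2 -[leRHS]mulr1 ler_wpM2l ?(ltW th0)//; lra.
have n1 : 1 <= n%:R :> R by rewrite ler1n.
(* (1 + 2 th)(1 + 14 n th) <= 1 + 23 n th, because th <= 1/4 and n >= 1. *)
have main (w : R) : `|w| <= `|v| + 2 * e -> expR (`|v| / 2) <= 1 + 14 * n%:R * th ->
    expR (`|w| / 2) <= 1 + 23 * th * n%:R.
  move=> wv hv; apply: (@le_trans _ _ (expR (e + `|v| / 2))); first by rewrite ler_expR; lra.
  rewrite expRD; apply: (@le_trans _ _ ((1 + 2 * th) * (1 + 14 * n%:R * th))).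
    by apply: ler_pM; rewrite ?expR_ge0//; lra.
  have h3 : th * (n%:R * th) <= 4^-1 * (n%:R * th).
    by rewrite ler_wpM2r// mulr_ge0 ?ler0n ?(ltW th0).
  have h4 : th * 1 <= th * n%:R by rewrite ler_wpM2l ?(ltW th0).
  lra.
apply: main.
  have := ler_normD (lsum F (n * cq c k.+1) x - v) v; rewrite subrK; lra.
by case: (ger0P v) => hv; rewrite ?sE ?sN.
Qed.

End Fundamental.

Lemma tower_growth b x : (b <= ca c k)%N ->
  expR (`|lsum F (b * cq c k.+1) x| / 2) <= 1 + 23 * th * b%:R.
Proof.
have [z <-] := cret_surj c k x; exact: (tower_growth_base (erefl (cdisp c k z))).
Qed.

End Tower.

(** * Combination of the levels *)

Section Growth.
Context {R : realType} (F : free_lift R).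
Implicit Types (x y : R) (k n b : nat).

Lemma dlslope_bounded : exists M, forall x, `|dlslope F x| <= M.
Proof.
have [M _ hM] := periodic_continuous_bounded (@dlslope_continuous _ F) (dlslopeD1 F).
by exists M.
Qed.

Lemma lslope_bounded : exists2 B, 0 <= B & forall x, `|lslope F x| <= B.
Proof.
apply: periodic_continuous_bounded (lslopeD1 F) => x.
exact: is_derive_continuous (lslope_derive F x).
Qed.

Lemma tower_growth_small (c : convergents F) (e : R) : 0 < e -> exists K, forall k b x,
  (K <= k)%N -> (b <= ca c k)%N ->
  expR (`|lsum F (b * cq c k.+1) x| / 2) <= 1 + e * b%:R.
Proof.
move=> e0; have [M hM] := dlslope_bounded.
pose th : R := Num.min 4^-1 (e / 23).
have th23 : 23 * th <= e by rewrite mulrC -ler_pdivlMr// /th ge_min lexx orbT.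
have th0 : 0 < th by rewrite /th lt_min divr_gt0 ?invr_gt0 ?ltr0n.
have th4 : th <= 4^-1 by rewrite ge_min lexx.
have t20 : 0 < th ^+ 2 by rewrite exprn_gt0.
have [K1 h1] := lsum_cq_small c hM t20.
have [K2 h2] := dlsum_small c hM t20.
exists (maxn K1 K2) => k b x; rewrite geq_max => /andP[k1 k2] ba.
apply: le_trans (tower_growth th0 th4 erefl (fun x => h1 k x k1) (fun x => h1 k.+1 x (leqW k1)) (fun x => h2 k x k2) x ba) _.
by rewrite lerD2l ler_wpM2r.
Qed.

Lemma half_growth_add n m x : expR (`|lsum F (n + m) x| / 2) <=
  expR (`|lsum F n x| / 2) * expR (`|lsum F m (iter n F x)| / 2).
Proof.
rewrite -expRD ler_expR lsumD; have := ler_normD (lsum F n x) (lsum F m (iter n F x)); lra.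
Qed.

(* The rate comes from (1 + a/8)(q_(k+1) + q_k) <= 3/4 (q_(k+2) + q_(k+1)) for
   q_(k+2) = a q_(k+1) + q_k. *)
Lemma half_growth_level (c : convergents F) : exists K, exists2 C : R, 0 < C &
  forall k n x, (K <= k)%N -> (n < cq c k.+1)%N ->
    expR (`|lsum F n x| / 2) <= C * (3 / 4) ^+ k * ((cq c k.+1)%:R + (cq c k)%:R).
Proof.
(* The ratio of consecutive sums q_(k+1) + q_k is at least 1 + a/2, while q_(k+2) / q_(k+1) alone
   may be close to 1. With 1/8, 1 + a/8 <= 3/4 (1 + a/2) holds for every a >= 1, with equality at a
   = 1. *)
have e8 : 0 < 8^-1 :> R by [].
have [K hK] := tower_growth_small c e8.
have [B B0 hB] := lslope_bounded.
have t0 k : 0 < (3 / 4) ^+ k :> R by rewrite exprn_gt0//; lra.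
(* C is chosen for the base level K, where |L_n| <= n B suffices. *)
pose C := expR ((cq c K.+1)%:R * B / 2) / (3 / 4) ^+ K.
have C0 : 0 < C by rewrite divr_gt0// expR_gt0.
exists K, C => //.
move=> k n x Kk; rewrite -(subnK Kk); move: (k - K)%N => {k Kk}m.
elim: m n x => [|m ih] n x nq.
  have -> : C * (3 / 4) ^+ K = expR ((cq c K.+1)%:R * B / 2) by rewrite /C divfK// gt_eqF.
  apply: (@le_trans _ _ (expR ((cq c K.+1)%:R * B / 2))).
    rewrite ler_expR; suff : `|lsum F n x| <= (cq c K.+1)%:R * B by lra.
    apply: le_trans (ler_norm_sum _ _ _) _.
    apply: (@le_trans _ _ (\sum_(i < n) B)); first by apply: ler_sum => i _; exact: hB.
    by rewrite sumr_const card_ord -(mulr_natl B n) ler_wpM2r// ler_nat ltnW.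
  rewrite -[leLHS]mulr1 ler_wpM2l ?expR_ge0// -natrD ler1n.
  by rewrite (leq_trans (cq_gt0 c K))// leq_addr.
rewrite addSn in nq *; set k := (m + K)%N in nq ih *.
have q1 := cq_gt0 c k.
pose b := (n %/ cq c k.+1)%N; pose r := (n %% cq c k.+1)%N.
have en : n = (b * cq c k.+1 + r)%N by exact: divn_eq.
have rq : (r < cq c k.+1)%N by rewrite ltn_mod.
have ba : (b <= ca c k)%N.
  rewrite -ltnS ltn_divLR//; apply: leq_trans nq _.
  by rewrite cqSS mulSn addnC leq_add2r cq_leS.
rewrite en; apply: le_trans (half_growth_add _ _ _) _.
have Kk : (K <= k)%N by rewrite leq_addl.
have h := ler_pM (expR_ge0 _) (expR_ge0 _) (hK k b x Kk ba) (ih r (iter (b * cq c k.+1) F x) rq).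
apply: (le_trans h); rewrite exprS.
set D := C * (3 / 4) ^+ k; have D0 : 0 <= D by rewrite mulr_ge0 ?ltW.
rewrite (_ : C * (3 / 4 * (3 / 4) ^+ k) * _ = D * (3 / 4 * ((cq c k.+2)%:R + (cq c k.+1)%:R))); last by rewrite /D; ring.
rewrite mulrCA ler_wpM2l//.
have a1 : 1 <= (ca c k)%:R :> R by rewrite ler1n ca_gt0.
have ba' : b%:R <= (ca c k)%:R :> R by rewrite ler_nat.
have q01 : (cq c k)%:R <= (cq c k.+1)%:R :> R by rewrite ler_nat cq_leS.
have q00 : 0 <= (cq c k)%:R :> R by [].
rewrite cqSS natrD natrM.
move: a1 ba' q01 q00; set a := (ca c k)%:R; set b' := b%:R; set u := (cq c k)%:R; set v := (cq c k.+1)%:R.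
move=> a1 ba' q01 q00.
have h1 : (8^-1 * b') * (v + u) <= (8^-1 * a) * (v + u) by rewrite ler_wpM2r ?ler_wpM2l//; lra.
have h2 : a * u <= a * v by rewrite ler_wpM2l//; lra.
have h3 : v <= a * v by rewrite -[leLHS]mul1r ler_wpM2r//; lra.
lra.
Qed.

(** The absolute value covers the inverse too: the slope of F^(-n) at F^n x is exp (- L_n x). *)
Lemma core_growth (e : R) : 0 < e -> exists N, forall n x, (N <= n)%N ->
  expR `|lsum F n x| <= e * n%:R ^+ 2.
Proof.
move=> e0; have [c] := convergents_exist F.
have [K1 [C C0 hC]] := half_growth_level c.
(* The leading digit b needs no gain: 1 + b <= 2 b and b q_(k+1) <= n. The decay comes from the
   lower digits through (3/4)^k. *)
have [K2 hK2] := tower_growth_small c (@ltr01 R).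
(* After squaring, one factor (3/4)^k absorbs 16 C^2 and leaves e; the other is bounded by 1. *)
have d0 : 0 < e / (16 * C ^+ 2) by rewrite divr_gt0// mulr_gt0// exprn_gt0.
have /cvgrPdist_lt/(_ _ d0)[K3 _ hK3] : (3 / 4 : R) ^+ n @[n --> \oo] --> 0.
  by apply: cvg_expr; rewrite ger0_norm; lra.
pose K := maxn K1 (maxn K2 K3).
exists (cq c K.+1) => n x Kn.
have ex : exists m, (n < cq c m.+1)%N by exists n.+1; exact: (cq_ge c n.+1).
case: (ex_minnP ex) => m hm hmin.
have mono i j : (i <= j)%N -> (cq c i <= cq c j)%N.
  by move=> ij; rewrite -(subnK ij); elim: (j - i)%N => // l ih; apply: leq_trans ih _; rewrite addSn cq_leS.
have Km : (K < m)%N.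
  by rewrite ltnNge; apply/negP => mK; have := leq_trans hm (leq_trans (mono m.+1 K.+1 mK) Kn); rewrite ltnn.
case: m hm hmin Km => // k hm hmin; rewrite ltnS !geq_max => /and3P[k1 k2 k3].
have nq : (cq c k.+1 <= n)%N by rewrite leqNgt; apply/negP => /hmin; rewrite ltnn.
have q1 := cq_gt0 c k.
pose b := (n %/ cq c k.+1)%N; pose r := (n %% cq c k.+1)%N.
have en : n = (b * cq c k.+1 + r)%N by exact: divn_eq.
have rq : (r < cq c k.+1)%N by rewrite ltn_mod.
have ba : (b <= ca c k)%N.
  rewrite -ltnS ltn_divLR//; apply: leq_trans hm _.
  by rewrite cqSS mulSn addnC leq_add2r cq_leS.
have b1 : (0 < b)%N by rewrite divn_gt0.
have h1 := half_growth_add (b * cq c k.+1) r x; rewrite -en in h1.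
have h2 := ler_pM (expR_ge0 _) (expR_ge0 _) (hK2 k b x k2 ba) (hC k r (iter (b * cq c k.+1) F x) k1 rq).
have {h1 h2} h := le_trans h1 h2.
have b1' : 1 <= b%:R :> R by rewrite ler1n.
have q01 : (cq c k)%:R <= (cq c k.+1)%:R :> R by rewrite ler_nat cq_leS.
have bqn : b%:R * (cq c k.+1)%:R <= n%:R :> R by rewrite -natrM ler_nat [leqRHS]en leq_addr.
have t0 : 0 < (3 / 4) ^+ k :> R by rewrite exprn_gt0//; lra.
have D0 : 0 < C * (3 / 4) ^+ k by rewrite mulr_gt0.
have h4 : expR (`|lsum F n x| / 2) <= 4 * (C * (3 / 4) ^+ k) * n%:R.
  apply: (le_trans h).
  have a1 : (1 + 1 * b%:R) * (C * (3 / 4) ^+ k * ((cq c k.+1)%:R + (cq c k)%:R)) <=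
    (2 * b%:R) * (C * (3 / 4) ^+ k * (2 * (cq c k.+1)%:R)).
    apply: ler_pM.
    - lra.
    - by rewrite mulr_ge0 ?addr_ge0 ?(ltW D0).
    - lra.
    - by apply: ler_wpM2l; [exact: ltW|lra].
  apply: (le_trans a1).
  have := ler_wpM2l (ltW D0) bqn; lra.
have -> : expR `|lsum F n x| = expR (`|lsum F n x| / 2) ^+ 2.
  by rewrite -expRM_natl; congr expR; field.
have h5 : expR (`|lsum F n x| / 2) ^+ 2 <= (4 * (C * (3 / 4) ^+ k) * n%:R) ^+ 2.
  by rewrite lerXn2r// nnegrE ?expR_ge0// mulr_ge0// mulr_ge0// ltW.
apply: (le_trans h5).
rewrite (_ : _ ^+ 2 = 16 * C ^+ 2 * (3 / 4) ^+ k * (3 / 4) ^+ k * n%:R ^+ 2); last by ring.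
apply: ler_wpM2r; first exact: sqr_ge0.
have := hK3 k k3; rewrite /= sub0r normrN (ger0_norm (ltW t0)) => /ltW.
rewrite ler_pdivlMr ?mulr_gt0 ?exprn_gt0// => h6.
have t1 : (3 / 4) ^+ k <= 1 :> R by rewrite exprn_ile1//; lra.
have h7 : (16 * C ^+ 2 * (3 / 4) ^+ k) * (3 / 4) ^+ k <= (16 * C ^+ 2 * (3 / 4) ^+ k) * 1.
  by apply: ler_wpM2l => //; apply: mulr_ge0; [apply: mulr_ge0; [|exact: sqr_ge0]|exact: ltW].
by apply: (le_trans h7); lra.
Qed.

End Growth.

(** * Circle maps and their lifts *)

Section Circle.
Context {R : realType}.
Implicit Types (x y : circle R) (s t : R).

Lemma circle_projD s t : circle_proj (s + t) = circle_proj s + circle_proj t.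
Proof. exact: raddfD. Qed.

Lemma circle_projB s t : circle_proj (s - t) = circle_proj s - circle_proj t.
Proof. exact: raddfB. Qed.

Lemma circle_projN t : circle_proj (- t) = - circle_proj t.
Proof. exact: raddfN. Qed.

Lemma circle_proj0 : circle_proj 0 = 0 :> circle R.
Proof. exact: raddf0. Qed.

Lemma circle_projK x : circle_proj (repr x) = x.
Proof. exact: reprK. Qed.

Lemma circle_proj_eq s t : circle_proj s = circle_proj t <-> exists m : int, s = t + m%:~R.
Proof.
split=> [|[m ->]].
  move=> /eqP; rewrite /circle_proj -Quotient.idealrBE => /intrP[m e].
  by exists m; rewrite -e addrC subrK.
by apply/eqP; rewrite /circle_proj -Quotient.idealrBE addrAC subrr add0r; apply: intr_int.
Qed.

Lemma circle_projDz t (m : int) : circle_proj (t + m%:~R) = circle_proj t.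
Proof. by apply/circle_proj_eq; exists m. Qed.

Lemma centered_reprK x : circle_proj (centered_repr x) = x.
Proof. by rewrite /centered_repr -mulrNz circle_projDz circle_projK. Qed.

Lemma centered_repr_itv x : - 2^-1 <= centered_repr x < 2^-1.
Proof.
rewrite /centered_repr; have := Num.Theory.floor_itv (repr x + 2^-1).
rewrite intrD => /andP[? ?]; apply/andP; split; lra.
Qed.

Lemma centered_repr_proj t : - 2^-1 <= t < 2^-1 -> centered_repr (circle_proj t) = t.
Proof.
move=> ht; have := centered_repr_itv (circle_proj t).
have /circle_proj_eq[m ->] := centered_reprK (circle_proj t).
have [m1|m0|->] := ltrgtP m 0; last by rewrite addr0.
- by move: m1; rewrite -lezD1 -(ler_int R) intrD; lra.
- by move: m0; rewrite -lezD1 add0r -(ler_int R); lra.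
Qed.

Definition circle_norm x : R := `|centered_repr x|.

Lemma circle_norm_proj t : circle_norm (circle_proj t) <= `|t|.
Proof.
have [ht|] := boolP (- 2^-1 <= t < 2^-1).
  by rewrite /circle_norm centered_repr_proj.
rewrite negb_and -!ltNge => ht; apply: (@le_trans _ _ 2^-1).
  by have /andP[? ?] := centered_repr_itv (circle_proj t); rewrite ler_norml; apply/andP; split; lra.
by have := ler_norm t; have := ler_norm (- t); rewrite normrN; case/orP: ht; lra.
Qed.

Lemma circle_normD x y : circle_norm (x + y) <= circle_norm x + circle_norm y.
Proof.
rewrite -{1}[x]centered_reprK -{1}[y]centered_reprK -circle_projD.
exact: le_trans (circle_norm_proj _) (ler_normD _ _).
Qed.

Lemma circle_norm_eq0 x : circle_norm x = 0 -> x = 0.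
Proof.
move/normr0P => /eqP h; by rewrite -[x]centered_reprK h circle_proj0.
Qed.

Lemma circle_normN x : circle_norm (- x) = circle_norm x.
Proof.
have le z : circle_norm (- z) <= circle_norm z.
  rewrite -{1}[z]centered_reprK -circle_projN.
  by apply: le_trans (circle_norm_proj _) _; rewrite normrN.
by apply/eqP; rewrite eq_le le /= -{1}[x]opprK le.
Qed.

Lemma circle_norm0 : circle_norm 0 = 0.
Proof.
apply/eqP; rewrite eq_le normr_ge0 andbT.
by have := circle_norm_proj 0; rewrite normr0 circle_proj0.
Qed.

(** The distance to a fixed value c t is a real function with derivative 0 that vanishes at t. *)
Lemma circle_zero_derivative_cst (c : R -> circle R) :
  (forall t (e : R), 0 < e -> \forall h \near (0 : R)^', circle_norm (c (t + h) - c t) <= e * `|h|) ->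
  forall s t, c s = c t.
Proof.
move=> hc s t; pose phi (r : R) : R := circle_norm (c r - c t).
have dphi (r : R) : is_derive r (1 : R) phi 0.
  have cv : (fun h : R => h^-1 *: ((phi \o shift r) (h *: (1 : R)) - phi r)) @ 0^' --> (0 : R).
    apply/cvgrPdist_le => e e0; have := hc r e e0; apply: filterS2 (nbhs_dnbhs_neq (0 : R)) => h h0 hh.
    rewrite sub0r normrN normrZ normfV ler_pdivrMl ?normr_gt0// mulrC.
    apply: le_trans hh; rewrite /phi /= /shift /= [h *: _]mulr1 (addrC h).
    rewrite ler_norml; apply/andP; split.
      have := circle_normD (c (r + h) - c t) (- (c (r + h) - c r)).
      rewrite circle_normN opprB [_ + (c r - _)]addrC addrA subrK; lra.
    have := circle_normD (c (r + h) - c r) (c r - c t).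
    rewrite addrA subrK; lra.
  by split; [apply/cvg_ex; exists 0|exact: cvg_lim cv].
have := @is_derive_0_is_cst R phi s t dphi.
rewrite /phi subrr circle_norm0 => /circle_norm_eq0/eqP; rewrite subr_eq0 => /eqP.
exact.
Qed.

End Circle.

Section Lifts.
Context {R : realType}.
Implicit Types (f g : circle R -> circle R) (L : R -> R) (s t : R).

Definition lifts f L := forall t, f (circle_proj t) = circle_proj (L t).

Lemma lifts_iter f L n : lifts f L -> lifts (iter n f) (iter n L).
Proof. by move=> h t; elim: n => //= n ->; rewrite h. Qed.

Lemma is_derive_cvg L t (d : R) : is_derive t (1 : R) L d ->
  (L (t + h) - L t) / h @[h --> (0 : R)^'] --> d.
Proof.
move=> [ex <-]; rewrite /derive.
have -> : (fun h => (L (t + h) - L t) / h) =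
    (fun h : R => h^-1 *: ((L \o shift t) (h *: (1 : R)) - L t)).
  by apply/funext => h; rewrite /= /shift /= [h *: _]mulr1 (addrC h) mulrC.
exact: ex.
Qed.

Lemma lifts_circle_derive f L t (d : R) : lifts f L -> is_derive t (1 : R) L d ->
  circle_derive f (circle_proj t) = d.
Proof.
move=> hL dL; apply: cvg_lim => //.
have h := is_derive_cvg dL.
have Lc : {for t, continuous L} := is_derive_continuous dL.
have e0 : 0 < 2^-1 :> R by rewrite invr_gt0.
have near0 : \forall h \near (0 : R)^', `|L (t + h) - L t| < 2^-1.
  have /cvgrPdist_lt/(_ _ e0) : L (t + h) @[h --> (0 : R)^'] --> L t.
    have := (continuous_withinNshiftx L t).2 Lc.
    by rewrite (_ : L \o shift t = fun h => L (t + h))//; apply/funext => z; rewrite /= addrC.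
  by apply: filterS => x; rewrite distrC.
apply: cvg_trans h; apply: near_eq_cvg; apply: filterS near0 => x hx.
rewrite /circle_quotient -circle_projD !hL -circle_projB centered_repr_proj//.
by move: hx; rewrite ltr_norml => /andP[h1 h2]; apply/andP; split; [exact: ltW|].
Qed.

(** No covering theory: L is a primitive of the derivative that starts at a representative of f(0),
    and the R/Z-valued difference of f and L has derivative 0. *)
Lemma lift_exists f : (forall x, circle_derivable f x) ->
  (forall t, derivable (circle_derive f \o circle_proj) t 1) ->
  exists2 L, lifts f L &
    forall t : R, is_derive t (1 : R) L (circle_derive f (circle_proj t)).
Proof.
move=> df dDf; pose D := circle_derive f \o (@circle_proj R).
have Dc : continuous D.
  by move=> t; apply/differentiable_continuous/derivable1_diffP; exact: dDf.
have [P hP] := exists_primitive Dc.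
pose L t := P t - (P 0 - repr (f (circle_proj 0))).
have dL (t : R) : is_derive t (1 : R) L (D t).
  by rewrite -[D t]subr0; have := hP t => ?; apply: is_deriveB.
exists L => // t; apply/eqP; rewrite -subr_eq0.
have -> : 0 = f (circle_proj 0) - circle_proj (L 0).
  by rewrite /L opprB addrCA subrr addr0 circle_projK subrr.
apply/eqP; apply: (@circle_zero_derivative_cst _ (fun t => f (circle_proj t) - circle_proj (L t))) => {}t e e0.
have e20 : 0 < e / 2 by lra.
have /cvgrPdist_le/(_ _ e20) h1 : circle_quotient f (circle_proj t) h @[h --> (0 : R)^'] --> D t.
  exact: df.
have /cvgrPdist_le/(_ _ e20) h2 := is_derive_cvg (dL t).
apply: filterS3 (nbhs_dnbhs_neq (0 : R)) h1 h2 => h h0 h1 h2.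
have -> : f (circle_proj (t + h)) - circle_proj (L (t + h)) - (f (circle_proj t) - circle_proj (L t)) =
    circle_proj (centered_repr (f (circle_proj t + circle_proj h) - f (circle_proj t)) - (L (t + h) - L t)).
  by rewrite circle_projB centered_reprK (circle_projB (L (t + h))) circle_projD !opprB [LHS]addrACA [RHS]addrACA [X in _ = _ + X]addrC.
apply: le_trans (circle_norm_proj _) _.
rewrite (_ : _ - _ = h * (circle_quotient f (circle_proj t) h - (L (t + h) - L t) / h)); last first.
  by rewrite /circle_quotient; field.
rewrite normrM mulrC ler_wpM2r//.
apply: le_trans (ler_distD (D t) _ _) _; rewrite distrC; lra.
Qed.

Lemma integer_valued_cst (u : R -> R) : continuous u ->
  (forall t, exists m : int, u t = m%:~R) -> forall s t, u s = u t.
Proof.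
move=> uc um s t; apply: is_derive_0_is_cst => x.
have /cvgrPdist_lt/(_ 1 ltr01) h : u y @[y --> x] --> u x by exact: uc.
apply: (@near_eq_is_derive _ _ _ (cst (u x))).
apply: filterS h => y; rewrite /cst; have [m ->] := um x; have [n ->] := um y.
rewrite -intrB -intr_norm -[1]/(1%:~R) ltr_int => h; congr _%:~R; lia.
Qed.

Lemma circle_projS t : circle_proj (t + 1) = circle_proj t.
Proof. exact: (circle_projDz t 1). Qed.

Lemma lifts_degree f L : lifts f L -> continuous L ->
  exists d : int, forall t, L (t + 1) = L t + d%:~R.
Proof.
move=> hL Lc; pose u t := L (t + 1) - L t.
have Lint t : exists m : int, u t = m%:~R.
  have /circle_proj_eq[m hm] : circle_proj (L (t + 1)) = circle_proj (L t).
    by rewrite -!hL circle_projS.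
  by exists m; rewrite /u hm addrAC subrr add0r.
have uc : continuous u.
  move=> t; apply: continuousB; last exact: Lc.
  by apply: continuous_comp; [apply: continuousD; [exact: cvg_id|exact: cvg_cst]|exact: Lc].
have [d hd] := Lint 0; exists d => t.
by rewrite -hd (integer_valued_cst uc Lint 0 t) /u [RHS]addrC subrK.
Qed.

Lemma lifts_inverse f g L K : lifts f L -> lifts g K -> continuous L -> continuous K ->
  cancel f g -> exists m : int, forall t, K (L t) = t + m%:~R.
Proof.
move=> hL hK Lc Kc fg; pose u t := K (L t) - t.
have uint t : exists m : int, u t = m%:~R.
  have /circle_proj_eq[m hm] : circle_proj (K (L t)) = circle_proj t.
    by rewrite -hK -hL fg.
  by exists m; rewrite /u hm addrAC subrr add0r.
have uc : continuous u.
  move=> t; apply: continuousB; last exact: cvg_id.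
  by apply: continuous_comp; [exact: Lc|exact: Kc].
have [m hm] := uint 0; exists m => t.
by rewrite -hm (integer_valued_cst uc uint 0 t) /u [RHS]addrC subrK.
Qed.

Lemma degreez L (d : int) : (forall t, L (t + 1) = L t + d%:~R) ->
  forall t (m : int), L (t + m%:~R) = L t + m%:~R * d%:~R.
Proof.
move=> hL t m; have h := @periodicz R (fun x => L x - x * d%:~R).
have := h (fun x => ltac:(rewrite hL; ring)) t m; lra.
Qed.

Lemma circle_inv_cancel f : bijective f -> cancel f (circle_inv f) /\ cancel (circle_inv f) f.
Proof.
move=> [h fh hf].
have inv y : circle_inv f y = h y.
  rewrite /circle_inv; case: xgetP => [x _ /= <-|/(_ (h y))]; first by rewrite fh.
  by rewrite /= hf.
by split=> x; rewrite inv.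
Qed.

Lemma is_derive_shift (a t : R) : is_derive t (1 : R) (fun x => x + a) 1.
Proof.
have h : is_derive t (1 : R) (@id R + cst a) (1 + 0) by exact: is_deriveD.
by rewrite addr0 in h.
Qed.

Section Diffeomorphism.
Context (f : circle R -> circle R).
Hypothesis f_diffeo : C2_diffeomorphism f.
Hypothesis f_aperiodic : forall x, ~ periodic_point f x.

Lemma aperiodic_lift : exists (F : free_lift R) (G : R -> R) (m : int),
  [/\ lifts f F, lifts (circle_inv f) G, forall t, F (G t) = t + m%:~R &
    forall t : R, is_derive t (1 : R) G (expR (- lslope F (G t)))].
Proof.
have [bij [fd [Dfd Df'c]] [gd [Dgd _]]] := f_diffeo.
have [fg gf] := circle_inv_cancel bij.
set g := circle_inv f in gd Dgd fg gf *.
have [F hF dF] := lift_exists fd Dfd; have [G hG dG] := lift_exists gd Dgd.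
have Fc : continuous F by move=> t; exact: is_derive_continuous (dF t).
have Gc : continuous G by move=> t; exact: is_derive_continuous (dG t).
have [m hm] := lifts_inverse hF hG Fc Gc fg.
have [m' hm'] := lifts_inverse hG hF Gc Fc gf.
have [d hd] := lifts_degree hF Fc; have [d' hd'] := lifts_degree hG Gc.
pose D t := circle_derive f (circle_proj t).
have chain t : circle_derive g (circle_proj (F t)) * D t = 1.
  have d1 : is_derive t (1 : R) (G \o F) (circle_derive g (circle_proj (F t)) * D t).
    exact: is_derive1_comp.
  have d2 : is_derive t (1 : R) (G \o F) 1.
    rewrite (_ : G \o F = fun t => t + m%:~R); last by apply/funext.
    exact: is_derive_shift.
  by have [_ e1] := d1; have [_ e2] := d2; rewrite -e1 e2.
have Dc : continuous D by move=> t; apply/differentiable_continuous/derivable1_diffP; exact: Dfd.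
have D0 t : D t != 0.
  by apply: contra_eq_neq (chain t) => ->; rewrite mulr0 eq_sym oner_neq0.
have dd : d * d' = 1.
  have := hm (0 + 1); rewrite hd (degreez hd') hm.
  move=> h; apply/eqP; rewrite -(eqr_int R) intrM; apply/eqP; lra.
have d1 : d = 1.
  have [//|dN] : d = 1 \/ d = -1.
    by have /eqP := congr1 absz dd; rewrite abszM muln_eq1 => /andP[/eqP h _]; lia.
  (* In degree -1, F - id drops by 2 over a period and so takes an integer value, which gives a
     fixed point of f. *)
  exfalso; pose u t := F t - t.
  have u1 : u 1 = u 0 - 2 by have := hd 0; rewrite add0r dN mulrNz /u; lra.
  have uc : {within `[0, 1], continuous u}.
    by apply: continuous_subspaceT => t; apply: continuousB; [exact: Fc|exact: cvg_id].
  have [|t _ ht] := @IVT R u 0 1 (Num.floor (u 0))%:~R ler01 uc.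
    have := Num.Theory.floor_itv (u 0); rewrite u1 intrD ge_min le_max => /andP[h1 h2].
    by rewrite h1 /= andbT; apply/orP; right; lra.
  apply: (f_aperiodic (x := circle_proj t)); exists 1%N => //=.
  by rewrite hF; apply/circle_proj_eq; exists (Num.floor (u 0)); rewrite -ht /u addrC subrK.
rewrite d1 in hd.
(* The derivative never vanishes, by the chain rule with the inverse, and has mean 1 over a
   period. *)
have Dpos t : 0 < D t.
  have [xi _] := MVT_between 0 (0 + 1) dF.
  rewrite hd add0r subr0 mulr1 addrAC subrr add0r -/(D xi) => h1.
  have Dxi : 0 < D xi by rewrite -h1.
  rewrite lt_neqAle eq_sym D0 leNgt /=; apply/negP => Dt.
  have cw a b : {within `[a, b], continuous D} by apply: continuous_subspaceT.
  have [xt|tx] := leP xi t.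
    have [|z _ /eqP] := @IVT R D xi t 0 xt (cw _ _); last by rewrite (negbTE (D0 z)).
    by rewrite ge_min le_max (ltW Dt) (ltW Dxi) orbT.
  have [|z _ /eqP] := @IVT R D t xi 0 (ltW tx) (cw _ _); last by rewrite (negbTE (D0 z)).
  by rewrite ge_min le_max (ltW Dt) (ltW Dxi) orbT.
have dD (t : R) : is_derive t (1 : R) D (derive1 D t).
  by split; [exact: Dfd|rewrite derive1E].
have D1 t : D (t + 1) = D t by rewrite /D circle_projS.
have D'1 t : derive1 D (t + 1) = derive1 D t.
  have h1 : is_derive t (1 : R) (D \o (fun x => x + 1)) (derive1 D (t + 1) * 1).
    have h0 := is_derive_shift 1 t; have hD := dD (t + 1).
    exact: is_derive1_comp.
  have h2 : D \o (fun x => x + 1) = D by apply/funext => x; exact: D1.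
  rewrite h2 mulr1 in h1.
  by have [_ <-] := h1; rewrite derive1E.
pose lslo t := ln (D t); pose dlslo t := (D t)^-1 * derive1 D t.
have hexp t : expR (lslo t) = D t by rewrite lnK// posrE.
have A1 x : F (x + 1) = F x + 1 by exact: hd.
have A2 x : lslo (x + 1) = lslo x by rewrite /lslo D1.
have A3 x : dlslo (x + 1) = dlslo x by rewrite /dlslo D1 D'1.
have A4 y : exists x, F x = y.
  exists (G y - m'%:~R); have := degreez hd (G y) (- m').
  by rewrite mulrNz hm' => ->; rewrite mulr1 addrK.
have A5 (x : R) : is_derive x (1 : R) F (expR (lslo x)) by rewrite hexp; exact: dF.
have A6 (x : R) : is_derive x (1 : R) lslo (dlslo x).
  by have h1 := is_derive1_ln (Dpos x); have h2 := dD x; exact: is_derive1_comp.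
have A7 : continuous dlslo.
  by move=> x; apply: cvgM; [apply: cvgV; [exact: D0|exact: Dc]|exact: Df'c].
have A8 n (l : int) x : (0 < n)%N -> iter n F x <> x + l%:~R.
  move=> n0 h; apply: (f_aperiodic (x := circle_proj x)); exists n => //.
  by rewrite (lifts_iter n hF) h circle_projDz.
exists (FreeLift A1 A2 A3 A4 A5 A6 A7 A8), G, m'; split=> //= t.
suff -> : expR (- lslo (G t)) = circle_derive g (circle_proj t) by exact: dG.
rewrite expRN hexp.
have := chain (G t); rewrite hm' circle_projDz => h.
by rewrite -[LHS]mul1r -h mulfK.
Qed.

End Diffeomorphism.

End Lifts.

Lemma iter_inverse_derive (R : realType) (F : free_lift R) (G : R -> R) (m : int) :
  (forall t, F (G t) = t + m%:~R) ->
  (forall t : R, is_derive t (1 : R) G (expR (- lslope F (G t)))) ->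
  forall n (t : R), is_derive t (1 : R) (iter n G) (expR (- lsum F n (iter n G t))).
Proof.
move=> FG dG; elim=> [|n ih] t.
  by rewrite lsum0 oppr0 expR0; exact: is_derive_id.
have -> : expR (- lsum F n.+1 (iter n.+1 G t)) =
    expR (- lslope F (G (iter n G t))) * expR (- lsum F n (iter n G t)).
  rewrite -expRD -opprD; congr (expR (- _)).
  by rewrite -[n.+1]add1n lsumD /= FG lsumDz lsumS lsum0 add0r.
by have h1 := dG (iter n G t); have h2 := ih t; exact: is_derive1_comp.
Qed.

Theorem theorem1 (R : realType) (f : circle R -> circle R)
    (f_diffeo : C2_diffeomorphism f)
    (f_aperiodic : forall x : circle R, ~ periodic_point f x) :
  growth f n / (n%:R ^+ 2) @[n --> \oo] --> (0 : R).
Proof.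
have [F [G [m [hF hG FG dG]]]] := aperiodic_lift f_diffeo f_aperiodic.
apply/cvgrPdist_le => e e0; have [N hN] := core_growth F e0.
exists (maxn N 1) => // n /=; rewrite geq_max => /andP[Nn n0].
have n2 : 0 < (n%:R : R) ^+ 2 by rewrite exprn_gt0 ?ltr0n.
have bound (k : circle R -> circle R) : (forall x, `|circle_derive k x| <= e * n%:R ^+ 2) ->
    0 <= derive_norm k <= e * n%:R ^+ 2.
  move=> hk; apply/andP; split.
    apply: le_trans (normr_ge0 (circle_derive k 0)) _.
    apply: ub_le_sup; last by exists 0.
    by exists (e * n%:R ^+ 2) => _ [x _ <-].
  by apply: ge_sup; [exists `|circle_derive k 0|, 0|move=> _ [x _ <-]].
have /andP[f0 f1] : 0 <= derive_norm (iter n f) <= e * n%:R ^+ 2.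
  apply: bound => x; rewrite -[x]circle_projK.
  rewrite (lifts_circle_derive (lifts_iter n hF) (iter_derive F n (repr x))).
  rewrite ger0_norm ?expR_ge0//; apply: le_trans (hN n (repr x) Nn).
  by rewrite ler_expR ler_norm.
have /andP[g0 g1] : 0 <= derive_norm (iter n (circle_inv f)) <= e * n%:R ^+ 2.
  apply: bound => x; rewrite -[x]circle_projK.
  rewrite (lifts_circle_derive (lifts_iter n hG) (iter_inverse_derive FG dG n (repr x))).
  rewrite ger0_norm ?expR_ge0//; apply: le_trans (hN n (iter n G (repr x)) Nn).
  by rewrite ler_expR -normrN ler_norm.
rewrite sub0r normrN ger0_norm.
  by rewrite ler_pdivrMr// /growth ge_max f1 g1.
by rewrite divr_ge0 ?(ltW n2)// /growth le_max f0.
Qed.
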